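(* Assume that $q\in K^*$ is not a root of unity and let $z=a_{11}a_{22}^{-1}\in UT_q(2)$. Then the group of Hopf algebra automorphisms of $UT_q(2)$ is $$\mathcal H=\{\varphi\in\mathrm{Aut}(UT_q(2)):\ \varphi(a_{12})=\lambda z^ja_{12},\ \varphi(a_{ii})=z^ja_{ii}\ (i\in\{1,2\}),\ \text{for some }\lambda\in K^*,\ j\in\mathbb Z\}\cong K^*\times\mathbb Z.$$
   Context: $K$ is a field of characteristic different from $2$. $T_q(2)$ is the unital associative $K$-algebra generated by $a_{11},a_{12},a_{22}$ with relations $a_{22}a_{12}=qa_{12}a_{22}$, $a_{11}a_{12}=qa_{12}a_{11}$, $a_{11}a_{22}=a_{22}a_{11}$. $UT_q(2)$ is the localization of $T_q(2)$ at the multiplicative set generated by $a_{11}$ and $a_{22}$. It is a Hopf algebra with comultiplication and counit the algebra morphisms determined by $\Delta(a_{ii})=a_{ii}\otimes a_{ii}$ ($i=1,2$), $\Delta(a_{12})=a_{11}\otimes a_{12}+a_{12}\otimes a_{22}$, $\varepsilon(a_{11})=\varepsilon(a_{22})=1$, $\varepsilon(a_{12})=0$. $\mathrm{Aut}(A)$ is the group of $K$-algebra automorphisms of $A$. *)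

(* Defs.v *)
(* boolp (classical logic) gives decidable quotients by arbitrary congruences,
   and a unitRingType structure on arbitrary rings. *)
From HB Require Import structures.
From mathcomp Require Import all_boot all_order all_algebra.
From mathcomp Require Import boolp classical_sets.

Set Implicit Arguments.
Unset Strict Implicit.
Unset Printing Implicit Defensive.

Import GRing.Theory.
Local Open Scope ring_scope.
Local Open Scope quotient_scope.

Section ClassicUnit.
Variable R : nzRingType.

Definition cunit : pred R := fun x => `[< exists y, y * x = 1 /\ x * y = 1 >].

Definition cinv (x : R) : R :=
  if pselect (exists y, y * x = 1 /\ x * y = 1) is left h
  then projT1 (cid h) else x.

Lemma cmulVr : {in cunit, left_inverse 1 cinv *%R}.
Proof.
move=> x /asboolP h; rewrite /cinv; case: pselect => // h'.
by case: (projT2 (cid h')).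
Qed.

Lemma cmulrV : {in cunit, right_inverse 1 cinv *%R}.
Proof.
move=> x /asboolP h; rewrite /cinv; case: pselect => // h'.
by case: (projT2 (cid h')).
Qed.

Lemma cunitrP x y : y * x = 1 /\ x * y = 1 -> cunit x.
Proof. by move=> h; apply/asboolP; exists y. Qed.

Lemma cinv_out : {in [predC cunit], cinv =1 id}.
Proof.
move=> x; rewrite inE => nx; rewrite /cinv; case: pselect => // h.
by case/negP: nx; apply/asboolP.
Qed.

End ClassicUnit.

Section Presentation.
Variables (K : fieldType) (G : Type).

Inductive pterm : Type :=
  | Gen of G
  | TZero
  | TOne
  | TOpp of pterm
  | TAdd of pterm & pterm
  | TScale of K & pterm
  | TMul of pterm & pterm.

HB.instance Definition _ := gen_eqMixin pterm.
HB.instance Definition _ := gen_choiceMixin pterm.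

Section Congruence.
Variable rel : pterm -> pterm -> Prop.

(* The least congruence that contains [rel] and makes the quotient a unital
   associative K-algebra. *)
Inductive pcongr : pterm -> pterm -> Prop :=
  | PRel s t : rel s t -> pcongr s t
  | PRefl s : pcongr s s
  | PSym s t : pcongr s t -> pcongr t s
  | PTrans s t u : pcongr s t -> pcongr t u -> pcongr s u
  | POppC s t : pcongr s t -> pcongr (TOpp s) (TOpp t)
  | PAddC s t s' t' :
      pcongr s t -> pcongr s' t' -> pcongr (TAdd s s') (TAdd t t')
  | PScaleC k s t : pcongr s t -> pcongr (TScale k s) (TScale k t)
  | PMulC s t s' t' :
      pcongr s t -> pcongr s' t' -> pcongr (TMul s s') (TMul t t')
  | PaddA s t u : pcongr (TAdd s (TAdd t u)) (TAdd (TAdd s t) u)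
  | Paddc s t : pcongr (TAdd s t) (TAdd t s)
  | Padd0 s : pcongr (TAdd TZero s) s
  | PaddN s : pcongr (TAdd (TOpp s) s) TZero
  | PmulA s t u : pcongr (TMul s (TMul t u)) (TMul (TMul s t) u)
  | Pmul1l s : pcongr (TMul TOne s) s
  | Pmul1r s : pcongr (TMul s TOne) s
  | PmulDl s t u : pcongr (TMul (TAdd s t) u) (TAdd (TMul s u) (TMul t u))
  | PmulDr s t u : pcongr (TMul s (TAdd t u)) (TAdd (TMul s t) (TMul s u))
  | PscaleA k l s : pcongr (TScale k (TScale l s)) (TScale (k * l) s)
  | Pscale1 s : pcongr (TScale 1 s) s
  | PscaleDr k s t : pcongr (TScale k (TAdd s t)) (TAdd (TScale k s) (TScale k t))
  | PscaleDl k l s : pcongr (TScale (k + l) s) (TAdd (TScale k s) (TScale l s))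
  | PscaleAl k s t : pcongr (TScale k (TMul s t)) (TMul (TScale k s) t)
  | PscaleAr k s t : pcongr (TScale k (TMul s t)) (TMul s (TScale k t)).

Definition pcongrb (s t : pterm) : bool := `[< pcongr s t >].

Lemma pcongrb_refl : reflexive pcongrb.
Proof. by move=> s; apply/asboolP; exact: PRefl. Qed.

Lemma pcongrb_sym : symmetric pcongrb.
Proof. by move=> s t; apply/asboolP/asboolP; exact: PSym. Qed.

Lemma pcongrb_trans : transitive pcongrb.
Proof.
by move=> t s u /asboolP st /asboolP tu; apply/asboolP; exact: PTrans st tu.
Qed.

Canonical pcongr_equiv := EquivRel pcongrb pcongrb_refl pcongrb_sym pcongrb_trans.

(* MathComp algebras are nontrivial rings, so the quotient takes a proof [nt]
   that the relations do not collapse it. *)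
Definition presAlg of ~ pcongr TZero TOne := {eq_quot pcongr_equiv}.

Variable nt : ~ pcongr TZero TOne.
Local Notation P := (presAlg nt).

HB.instance Definition _ := Choice.copy P {eq_quot pcongr_equiv}.

Definition pcls (t : pterm) : P := \pi_{eq_quot pcongr_equiv} t.
Definition prep (x : P) : pterm := repr (x : {eq_quot pcongr_equiv}).

Lemma prepK x : pcls (prep x) = x.
Proof. exact: reprK. Qed.

Lemma pclsP s t : pcls s = pcls t <-> pcongr s t.
Proof.
split; first by move/eqquotP/asboolP.
by move=> h; apply/eqquotP/asboolP.
Qed.

Lemma pclsK t : pcongr (prep (pcls t)) t.
Proof. by apply/pclsP; rewrite prepK. Qed.

Lemma presAlg_ind (Q : P -> Prop) : (forall t, Q (pcls t)) -> forall x, Q x.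
Proof. by move=> h x; rewrite -(prepK x). Qed.

Definition padd (x y : P) : P := pcls (TAdd (prep x) (prep y)).
Definition popp (x : P) : P := pcls (TOpp (prep x)).
Definition pmul (x y : P) : P := pcls (TMul (prep x) (prep y)).
Definition pscale (k : K) (x : P) : P := pcls (TScale k (prep x)).

Lemma paddE s t : padd (pcls s) (pcls t) = pcls (TAdd s t).
Proof. by apply/pclsP; apply: PAddC; exact: pclsK. Qed.
Lemma poppE s : popp (pcls s) = pcls (TOpp s).
Proof. by apply/pclsP; apply: POppC; exact: pclsK. Qed.
Lemma pmulE s t : pmul (pcls s) (pcls t) = pcls (TMul s t).
Proof. by apply/pclsP; apply: PMulC; exact: pclsK. Qed.
Lemma pscaleE k s : pscale k (pcls s) = pcls (TScale k s).
Proof. by apply/pclsP; apply: PScaleC; exact: pclsK. Qed.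

Fact padd_A : associative padd.
Proof.
elim/presAlg_ind=> s; elim/presAlg_ind=> t; elim/presAlg_ind=> u.
by rewrite !paddE; apply/pclsP; exact: PaddA.
Qed.
Fact padd_C : commutative padd.
Proof.
elim/presAlg_ind=> s; elim/presAlg_ind=> t.
by rewrite !paddE; apply/pclsP; exact: Paddc.
Qed.
Fact padd_0 : left_id (pcls TZero) padd.
Proof. by elim/presAlg_ind=> s; rewrite paddE; apply/pclsP; exact: Padd0. Qed.
Fact padd_N : left_inverse (pcls TZero) popp padd.
Proof.
by elim/presAlg_ind=> s; rewrite poppE paddE; apply/pclsP; exact: PaddN.
Qed.

HB.instance Definition _ := GRing.isZmodule.Build P padd_A padd_C padd_0 padd_N.

Fact pmul_A : associative pmul.
Proof.
elim/presAlg_ind=> s; elim/presAlg_ind=> t; elim/presAlg_ind=> u.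
by rewrite !pmulE; apply/pclsP; exact: PmulA.
Qed.
Fact pmul_1l : left_id (pcls TOne) pmul.
Proof. by elim/presAlg_ind=> s; rewrite pmulE; apply/pclsP; exact: Pmul1l. Qed.
Fact pmul_1r : right_id (pcls TOne) pmul.
Proof. by elim/presAlg_ind=> s; rewrite pmulE; apply/pclsP; exact: Pmul1r. Qed.
Fact pmul_Dl : left_distributive pmul padd.
Proof.
elim/presAlg_ind=> s; elim/presAlg_ind=> t; elim/presAlg_ind=> u.
by rewrite !(pmulE, paddE); apply/pclsP; exact: PmulDl.
Qed.
Fact pmul_Dr : right_distributive pmul padd.
Proof.
elim/presAlg_ind=> s; elim/presAlg_ind=> t; elim/presAlg_ind=> u.
by rewrite !(pmulE, paddE); apply/pclsP; exact: PmulDr.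
Qed.
Fact pone_neq0 : pcls TOne != 0.
Proof. by apply/eqP => /pclsP h; apply: nt; exact: PSym. Qed.

HB.instance Definition _ := GRing.Zmodule_isNzRing.Build P
  pmul_A pmul_1l pmul_1r pmul_Dl pmul_Dr pone_neq0.

Fact pscale_A k l (x : P) : pscale k (pscale l x) = pscale (k * l) x.
Proof.
by elim/presAlg_ind: x => s; rewrite !pscaleE; apply/pclsP; exact: PscaleA.
Qed.
Fact pscale_1 : left_id 1 pscale.
Proof. by elim/presAlg_ind=> s; rewrite pscaleE; apply/pclsP; exact: Pscale1. Qed.
Fact pscale_Dr : right_distributive pscale padd.
Proof.
move=> k; elim/presAlg_ind=> s; elim/presAlg_ind=> t.
by rewrite !(pscaleE, paddE); apply/pclsP; exact: PscaleDr.
Qed.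
Fact pscale_Dl (x : P) k l : pscale (k + l) x = padd (pscale k x) (pscale l x).
Proof.
elim/presAlg_ind: x => s.
by rewrite !(pscaleE, paddE); apply/pclsP; exact: PscaleDl.
Qed.

HB.instance Definition _ := GRing.Zmodule_isLmodule.Build K P
  pscale_A pscale_1 pscale_Dr pscale_Dl.

Fact pscale_Al k (x y : P) : pscale k (pmul x y) = pmul (pscale k x) y.
Proof.
elim/presAlg_ind: x => s; elim/presAlg_ind: y => t.
by rewrite !(pscaleE, pmulE); apply/pclsP; exact: PscaleAl.
Qed.
HB.instance Definition _ := GRing.Lmodule_isLalgebra.Build K P pscale_Al.

Fact pscale_Ar k (x y : P) : pscale k (pmul x y) = pmul x (pscale k y).
Proof.
elim/presAlg_ind: x => s; elim/presAlg_ind: y => t.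
by rewrite !(pscaleE, pmulE); apply/pclsP; exact: PscaleAr.
Qed.
HB.instance Definition _ := GRing.Lalgebra_isAlgebra.Build K P pscale_Ar.

HB.instance Definition _ := GRing.NzRing_hasMulInverse.Build P
  (@cmulVr P) (@cmulrV P) (@cunitrP P) (@cinv_out P).

Definition pgen (g : G) : P := pcls (Gen g).

Lemma pcls0 : pcls TZero = 0. Proof. by []. Qed.
Lemma pcls1 : pcls TOne = 1. Proof. by []. Qed.
Lemma pclsN s : pcls (TOpp s) = - pcls s. Proof. by rewrite -poppE. Qed.
Lemma pclsD s t : pcls (TAdd s t) = pcls s + pcls t.
Proof. by rewrite -paddE. Qed.
Lemma pclsM s t : pcls (TMul s t) = pcls s * pcls t.
Proof. by rewrite -pmulE. Qed.
Lemma pclsZ k s : pcls (TScale k s) = k *: pcls s.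
Proof. by rewrite -pscaleE. Qed.
Definition pclsE := (pcls0, pcls1, pclsN, pclsD, pclsM, pclsZ).

Lemma pcls_rel s t : rel s t -> pcls s = pcls t.
Proof. by move=> h; apply/pclsP; exact: PRel. Qed.

End Congruence.

Section Lift.
Variables (rel : pterm -> pterm -> Prop) (B : algType K) (f : G -> B).

Fixpoint peval (t : pterm) : B :=
  match t with
  | Gen g => f g
  | TZero => 0
  | TOne => 1
  | TOpp s => - peval s
  | TAdd s u => peval s + peval u
  | TScale k s => k *: peval s
  | TMul s u => peval s * peval u
  end.

Definition respects := forall s t, rel s t -> peval s = peval t.

Lemma pcongr_eval : respects -> forall s t, pcongr rel s t -> peval s = peval t.
Proof.
move=> hf s t; elim=> //=.
- by move=> ? ? ? _ -> _ ->.
- by move=> ? ? _ ->.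
- by move=> ? ? ? ? _ -> _ ->.
- by move=> ? ? ? _ ->.
- by move=> ? ? ? ? _ -> _ ->.
- by move=> ? ? ?; rewrite addrA.
- by move=> ? ?; rewrite addrC.
- by move=> ?; rewrite add0r.
- by move=> ?; rewrite addNr.
- by move=> ? ? ?; rewrite mulrA.
- by move=> ?; rewrite mul1r.
- by move=> ?; rewrite mulr1.
- by move=> ? ? ?; rewrite mulrDl.
- by move=> ? ? ?; rewrite mulrDr.
- by move=> ? ? ?; rewrite scalerA.
- by move=> ?; rewrite scale1r.
- by move=> ? ? ?; rewrite scalerDr.
- by move=> ? ? ?; rewrite scalerDl.
- by move=> ? ? ?; rewrite scalerAl.
- by move=> ? ? ?; rewrite scalerAr.
Qed.

Lemma respects_nontriv : respects -> ~ pcongr rel TZero TOne.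
Proof.
by move=> hf /(pcongr_eval hf) /= /eqP; rewrite eq_sym (negPf (oner_neq0 _)).
Qed.

Variables (nt : ~ pcongr rel TZero TOne) (hf : respects).

Definition plift of respects := fun x : presAlg nt => peval (prep x).

Lemma plift_cls t : plift hf (pcls nt t) = peval t.
Proof. by apply: (pcongr_eval hf); exact: pclsK. Qed.

Lemma plift_gen g : plift hf (pgen nt g) = f g.
Proof. exact: plift_cls. Qed.

Lemma plift_is_linear : linear (plift hf).
Proof.
move=> k; elim/presAlg_ind=> s; elim/presAlg_ind=> t.
by rewrite -pclsZ -pclsD !plift_cls.
Qed.
HB.instance Definition _ :=
  GRing.isLinear.Build K (presAlg nt) B _ (plift hf) plift_is_linear.

Lemma plift_is_monoid_morphism : monoid_morphism (plift hf).
Proof.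
split; first by rewrite -pcls1 plift_cls.
by elim/presAlg_ind=> s; elim/presAlg_ind=> t; rewrite -pclsM !plift_cls.
Qed.
HB.instance Definition _ :=
  GRing.isMonoidMorphism.Build (presAlg nt) B (plift hf) plift_is_monoid_morphism.

End Lift.
End Presentation.

Arguments Gen {K G}.
Arguments TZero {K G}.
Arguments TOne {K G}.

Inductive mulset (R : pzRingType) (X : R -> Prop) : R -> Prop :=
  | MSone : mulset X 1
  | MSgen x : X x -> mulset X x
  | MSmul x y : mulset X x -> mulset X y -> mulset X (x * y).

Lemma mulset_unit (R : pzRingType) (B : unitRingType) (g : {rmorphism R -> B})
    (X : R -> Prop) :
  (forall x, X x -> g x \is a GRing.unit) ->
  forall x, mulset X x -> g x \is a GRing.unit.
Proof.
move=> h x; elim=> [||y z _ hy _ hz]; first by rewrite rmorph1 unitr1.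
- exact: h.
- by rewrite rmorphM unitrMl.
Qed.

Section Localization.
Variables (K : fieldType) (A : algType K) (S : A -> Prop).

(* The localization is A with a formal inverse adjoined to each s in S, that is,
   the universal S-inverting K-algebra under A; for an Ore set S it is the ring
   of fractions. *)
Let gen := (A + {s : A | S s})%type.
Let emb (a : A) : pterm K gen := Gen (inl a).
Let finv (s : {s : A | S s}) : pterm K gen := Gen (inr s).

Inductive loc_rel : pterm K gen -> pterm K gen -> Prop :=
  | LRadd a b : loc_rel (emb (a + b)) (TAdd (emb a) (emb b))
  | LRscale k a : loc_rel (emb (k *: a)) (TScale k (emb a))
  | LRone : loc_rel (emb 1) TOne
  | LRmul a b : loc_rel (emb (a * b)) (TMul (emb a) (emb b))
  | LRinvl s : loc_rel (TMul (finv s) (emb (sval s))) TOne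
  | LRinvr s : loc_rel (TMul (emb (sval s)) (finv s)) TOne.

Section LocLift.
Variables (B : unitAlgType K) (g : {lrmorphism A -> B}).

Definition loc_fun (x : gen) : B :=
  match x with inl a => g a | inr s => (g (sval s))^-1 end.

Lemma loc_respects :
  (forall s, S s -> g s \is a GRing.unit) -> respects loc_rel loc_fun.
Proof.
move=> h s t; case=> /=.
- exact: raddfD.
- by move=> k a; rewrite linearZ.
- exact: rmorph1.
- exact: rmorphM.
- by case=> u Su /=; rewrite mulVr ?h.
- by case=> u Su /=; rewrite mulrV ?h.
Qed.
End LocLift.

Variable nt : ~ pcongr loc_rel TZero TOne.

Definition loc := presAlg nt.
HB.instance Definition _ := GRing.UnitAlgebra.on loc.

Definition to_loc (a : A) : loc := pgen nt (inl a).

Lemma to_loc_is_linear : linear to_loc.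
Proof.
move=> k a b; rewrite /to_loc /pgen (pcls_rel nt (LRadd _ _)) pclsD.
by rewrite (pcls_rel nt (LRscale _ _)) pclsZ.
Qed.
HB.instance Definition _ := GRing.isLinear.Build K A loc _ to_loc to_loc_is_linear.

Lemma to_loc_is_monoid_morphism : monoid_morphism to_loc.
Proof.
split; first by rewrite /to_loc /pgen (pcls_rel nt LRone) pcls1.
by move=> a b; rewrite /to_loc /pgen (pcls_rel nt (LRmul _ _)) pclsM.
Qed.
HB.instance Definition _ :=
  GRing.isMonoidMorphism.Build A loc to_loc to_loc_is_monoid_morphism.

Lemma to_loc_unit s : S s -> to_loc s \is a GRing.unit.
Proof.
move=> Ss; pose u := exist S s Ss; apply/unitrP; exists (pgen nt (inr u)).
rewrite /to_loc /pgen -!pclsM -pcls1.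
by rewrite (pcls_rel nt (LRinvl u)) (pcls_rel nt (LRinvr u)).
Qed.

End Localization.

Arguments loc_rel {K A} S _ _.

Section SeparatingForm.
Variables (K : fieldType) (V : lmodType K) (v : V).
Hypothesis v0 : v != 0.

Lemma separating_form : exists f : V -> K^o, linear f /\ f v != 0.
Proof.
pose P := [set W : set V | ~ W v /\ (forall (k : K) (x y : V), W x -> W y -> W (k *: x + y))]%classic.
have /= := @Zorn_bigcup V P.
case.
  move=> F FP Ftot; split.
    by case=> W /FP [].
  move=> k x y [W1 FW1 W1x] [W2 FW2 W2y].
  case: (Ftot _ _ FW1 FW2) => sub.
    by exists W2 => //; case: (FP _ FW2) => _; apply => //; exact: sub.
  by exists W1 => //; case: (FP _ FW1) => _; apply => //; exact: sub.
move=> W [[Wv Wlin] Wmax].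
have W0 : W 0.
  apply: contrapT => nW0.
  have W_empty x : ~ W x.
    by move=> Wx; apply: nW0; have := Wlin (-1) _ _ Wx Wx; rewrite scaleN1r addNr.
  apply: (Wmax [set 0]%classic).
    split; last by move=> /(_ 0 erefl); exact: W_empty.
    by move=> x /W_empty.
  split; first by move=> /= e; move: v0; rewrite e eqxx.
  by move=> k x y /= -> ->; rewrite scaler0 addr0.
have WZ k x : W x -> W (k *: x).
  by move=> Wx; rewrite -[_ *: _]addr0; apply: Wlin.
have WD x y : W x -> W y -> W (x + y).
  by move=> Wx Wy; rewrite -[x]scale1r; apply: Wlin.
have ex x : exists k, W (x - k *: v).
  have [Wx|nWx] := pselect (W x); first by exists 0; rewrite scale0r subr0.
  pose W' := [set y | exists2 w, W w & exists k, y = w + k *: x]%classic.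
  have W'v : W' v.
    apply: contrapT => nW'v; apply: (Wmax W').
      split; first by move=> w Ww; exists w => //; exists 0; rewrite scale0r addr0.
      move=> /(_ x) h; apply: nWx; apply: h.
      by exists 0 => //; exists 1; rewrite scale1r add0r.
    split=> // k y z [w1 Ww1 [k1 ->]] [w2 Ww2 [k2 ->]].
    exists (k *: w1 + w2); first exact: Wlin.
    by exists (k * k1 + k2); rewrite scalerDr scalerA scalerDl addrACA.
  case: W'v => w Ww [k vE].
  have k0 : k != 0.
    by apply/eqP => k0; apply: Wv; rewrite vE k0 scale0r addr0.
  exists k^-1; rewrite {1}vE scalerDr scalerA mulVf // scale1r opprD addrCA subrr.
  by rewrite addr0 -scaleN1r; apply: (WZ); apply: WZ.
pose f (x : V) : K^o := projT1 (cid (ex x)).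
have fP x : W (x - f x *: v) := projT2 (cid (ex x)).
have f_uniq x k : W (x - k *: v) -> f x = k.
  move=> h; apply/eqP; rewrite -subr_eq0; apply/negPn/negP => d0; apply: Wv.
  have -> : v = (f x - k)^-1 *: ((-1) *: (x - f x *: v) + (x - k *: v)).
    by rewrite scaleN1r opprB addrA subrK -scalerBl scalerA mulVf ?scale1r.
  by apply: (WZ); apply: WD => //; apply: (WZ).
exists f; split.
  move=> k x y; apply: f_uniq.
  have -> : k *: x + y - (k * f x + f y) *: v
     = k *: (x - f x *: v) + (y - f y *: v).
    by rewrite scalerDl scalerBr scalerA opprD addrACA.
  by apply: Wlin.
by rewrite (f_uniq v 1) ?oner_neq0 // scale1r subrr.
Qed.

End SeparatingForm.

Section Tensor.
Variables (K : fieldType) (A B : algType K).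

(* A list of pairs [:: (a1, b1); ..; (an, bn)] stands for the sum of the ai (x) bi;
   scalars need no separate formal coefficients since k (a (x) b) = (k a) (x) b. *)
Inductive tcongr : seq (A * B) -> seq (A * B) -> Prop :=
  | TRefl s : tcongr s s
  | TSym s t : tcongr s t -> tcongr t s
  | TTrans s t u : tcongr s t -> tcongr t u -> tcongr s u
  | TCat s t s' t' : tcongr s t -> tcongr s' t' -> tcongr (s ++ s') (t ++ t')
  | TCatC s t : tcongr (s ++ t) (t ++ s)
  | TZl b : tcongr [:: (0, b)] [::]
  | TDl a a' b : tcongr [:: (a + a', b)] [:: (a, b); (a', b)]
  | TDr a b b' : tcongr [:: (a, b + b')] [:: (a, b); (a, b')]
  | TZlr k a b : tcongr [:: (k *: a, b)] [:: (a, k *: b)].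

Definition tcongrb (s t : seq (A * B)) : bool := `[< tcongr s t >].

Lemma tcongrb_refl : reflexive tcongrb.
Proof. by move=> s; apply/asboolP; exact: TRefl. Qed.

Lemma tcongrb_sym : symmetric tcongrb.
Proof. by move=> s t; apply/asboolP/asboolP; exact: TSym. Qed.

Lemma tcongrb_trans : transitive tcongrb.
Proof.
by move=> t s u /asboolP st /asboolP tu; apply/asboolP; exact: TTrans st tu.
Qed.

Canonical tcongr_equiv := EquivRel tcongrb tcongrb_refl tcongrb_sym tcongrb_trans.

Definition tens := {eq_quot tcongr_equiv}.

HB.instance Definition _ := Choice.copy tens {eq_quot tcongr_equiv}.

Definition tcls (s : seq (A * B)) : tens := \pi_{eq_quot tcongr_equiv} s.
Definition trep (x : tens) : seq (A * B) := repr (x : {eq_quot tcongr_equiv}).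

Lemma trepK x : tcls (trep x) = x.
Proof. exact: reprK. Qed.

Lemma tclsP s t : tcls s = tcls t <-> tcongr s t.
Proof.
split; first by move/eqquotP/asboolP.
by move=> h; apply/eqquotP/asboolP.
Qed.

Lemma tclsK s : tcongr (trep (tcls s)) s.
Proof. by apply/tclsP; rewrite trepK. Qed.

Lemma tens_ind (Q : tens -> Prop) : (forall s, Q (tcls s)) -> forall x, Q x.
Proof. by move=> h x; rewrite -(trepK x). Qed.

Definition tpair_opp (p : A * B) : A * B := (- p.1, p.2).
Definition tpair_scale (k : K) (p : A * B) : A * B := (k *: p.1, p.2).
Definition tpair_mul (p r : A * B) : A * B := (p.1 * r.1, p.2 * r.2).

Lemma tcongr_map (h : A * B -> A * B) :
  (forall b, tcongr [:: h (0, b)] [::]) ->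
  (forall a a' b, tcongr [:: h (a + a', b)] [:: h (a, b); h (a', b)]) ->
  (forall a b b', tcongr [:: h (a, b + b')] [:: h (a, b); h (a, b')]) ->
  (forall k a b, tcongr [:: h (k *: a, b)] [:: h (a, k *: b)]) ->
  forall s t, tcongr s t -> tcongr (map h s) (map h t).
Proof.
move=> h1 h2 h3 h4 s t; elim=> //= {s t}.
- by move=> s; exact: TRefl.
- by move=> s t _; exact: TSym.
- by move=> s t u _ st _; exact: TTrans st.
- by move=> s t s' t' _ st _ st'; rewrite !map_cat; exact: TCat.
- by move=> s t; rewrite !map_cat; exact: TCatC.
Qed.

Lemma tcongr_opp s t : tcongr s t -> tcongr (map tpair_opp s) (map tpair_opp t).
Proof.
apply: tcongr_map => *; rewrite /tpair_opp /= ?oppr0 ?opprD -?scalerN.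
- exact: TZl.
- exact: TDl.
- exact: TDr.
- exact: TZlr.
Qed.

Lemma tcongr_scale k s t :
  tcongr s t -> tcongr (map (tpair_scale k) s) (map (tpair_scale k) t).
Proof.
apply: tcongr_map => *; rewrite /tpair_scale /= ?scaler0 ?scalerDr.
- exact: TZl.
- exact: TDl.
- exact: TDr.
- by rewrite scalerA mulrC -scalerA; exact: TZlr.
Qed.

Lemma tcongr_mull p s t :
  tcongr s t -> tcongr (map (tpair_mul p) s) (map (tpair_mul p) t).
Proof.
apply: tcongr_map => *; rewrite /tpair_mul /= ?mulr0 ?mulrDr -?scalerAr.
- exact: TZl.
- exact: TDl.
- exact: TDr.
- exact: TZlr.
Qed.

Lemma tcongr_mulr p s t :
  tcongr s t -> tcongr (map (tpair_mul^~ p) s) (map (tpair_mul^~ p) t).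
Proof.
apply: tcongr_map => *; rewrite /tpair_mul /= ?mul0r ?mulrDl -?scalerAl.
- exact: TZl.
- exact: TDl.
- exact: TDr.
- exact: TZlr.
Qed.

Definition tlmul (s t : seq (A * B)) := [seq tpair_mul p r | p <- s, r <- t].

Lemma tlmul_catl s s' t : tlmul (s ++ s') t = tlmul s t ++ tlmul s' t.
Proof. by rewrite /tlmul allpairs_cat. Qed.

Lemma tlmul_cons p s t : tlmul (p :: s) t = map (tpair_mul p) t ++ tlmul s t.
Proof. by []. Qed.

Lemma tlmul1 s p : tlmul s [:: p] = map (tpair_mul^~ p) s.
Proof. by elim: s => //= r s <-. Qed.

Lemma tlmul_congrr s t t' : tcongr t t' -> tcongr (tlmul s t) (tlmul s t').
Proof.
move=> h; elim: s => [|p s IH]; first exact: TRefl.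
by rewrite !tlmul_cons; apply: TCat IH; exact: tcongr_mull.
Qed.

Lemma tcongr_catACA s t u v : tcongr ((s ++ t) ++ (u ++ v)) ((s ++ u) ++ (t ++ v)).
Proof.
rewrite -!catA; apply: TCat; first exact: TRefl.
rewrite !catA; apply: TCat; last exact: TRefl.
exact: TCatC.
Qed.

Lemma tlmul_consr s p t :
  tcongr (tlmul s (p :: t)) (map (tpair_mul^~ p) s ++ tlmul s t).
Proof.
elim: s => [|r s IH]; first exact: TRefl.
rewrite !tlmul_cons /= -cat_cons -[_ :: map _ t]cat1s.
apply: (TTrans (TCat (TRefl _) IH)).
exact: (tcongr_catACA [:: _]).
Qed.

Lemma tlmul_nilr s : tlmul s [::] = [::].
Proof. by elim: s. Qed.

Lemma tlmul_congrl s s' t : tcongr s s' -> tcongr (tlmul s t) (tlmul s' t).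
Proof.
move=> h; elim: t => [|p t IH]; first by rewrite !tlmul_nilr; exact: TRefl.
apply: (TTrans (tlmul_consr _ _ _)); apply: TSym.
apply: (TTrans (tlmul_consr _ _ _)); apply: TSym.
by apply: TCat IH; exact: tcongr_mulr.
Qed.

Lemma tlmul_catr s t t' : tcongr (tlmul s (t ++ t')) (tlmul s t ++ tlmul s t').
Proof.
elim: t => [|p t IH] /=; first by rewrite tlmul_nilr; exact: TRefl.
apply: (TTrans (tlmul_consr _ _ _)).
apply: (TTrans (TCat (TRefl _) IH)); rewrite catA.
by apply: TCat; [apply: TSym; exact: tlmul_consr | exact: TRefl].
Qed.

Definition tadd (x y : tens) : tens := tcls (trep x ++ trep y).
Definition topp (x : tens) : tens := tcls (map tpair_opp (trep x)).
Definition tscale (k : K) (x : tens) : tens := tcls (map (tpair_scale k) (trep x)).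
Definition tmul (x y : tens) : tens := tcls (tlmul (trep x) (trep y)).

Lemma taddE s t : tadd (tcls s) (tcls t) = tcls (s ++ t).
Proof. by apply/tclsP; apply: TCat; exact: tclsK. Qed.
Lemma toppE s : topp (tcls s) = tcls (map tpair_opp s).
Proof. by apply/tclsP; apply: tcongr_opp; exact: tclsK. Qed.
Lemma tscaleE k s : tscale k (tcls s) = tcls (map (tpair_scale k) s).
Proof. by apply/tclsP; apply: tcongr_scale; exact: tclsK. Qed.
Lemma tmulE s t : tmul (tcls s) (tcls t) = tcls (tlmul s t).
Proof.
apply/tclsP; apply: (TTrans (tlmul_congrl _ (tclsK _))).
by apply: tlmul_congrr; exact: tclsK.
Qed.

Fact tadd_A : associative tadd.
Proof.
elim/tens_ind=> s; elim/tens_ind=> t; elim/tens_ind=> u.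
by rewrite !taddE catA.
Qed.
Fact tadd_C : commutative tadd.
Proof.
elim/tens_ind=> s; elim/tens_ind=> t.
by rewrite !taddE; apply/tclsP; exact: TCatC.
Qed.
Fact tadd_0 : left_id (tcls [::]) tadd.
Proof. by elim/tens_ind=> s; rewrite taddE. Qed.
Fact tadd_N : left_inverse (tcls [::]) topp tadd.
Proof.
elim/tens_ind=> s; rewrite toppE taddE; apply/tclsP.
elim: s => [|[a b] s IH]; first exact: TRefl.
apply: (TTrans (tcongr_catACA [:: tpair_opp (a, b)] _ [:: (a, b)] s)).
apply: (@TCat _ [::] _ [::]) IH.
rewrite /tpair_opp /=; apply: TTrans (TSym (TDl _ _ _)) _.
by rewrite addNr; exact: TZl.
Qed.

HB.instance Definition _ := GRing.isZmodule.Build tens tadd_A tadd_C tadd_0 tadd_N.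

Fact tscale_A k l (x : tens) : tscale k (tscale l x) = tscale (k * l) x.
Proof.
elim/tens_ind: x => s; rewrite !tscaleE -map_comp; congr tcls.
by apply: eq_map => p; rewrite /tpair_scale /= scalerA.
Qed.
Fact tscale_1 : left_id 1 tscale.
Proof.
elim/tens_ind=> s; rewrite tscaleE -[in RHS](map_id s); congr tcls.
by apply: eq_map => -[a b]; rewrite /tpair_scale /= scale1r.
Qed.
Fact tscale_Dr : right_distributive tscale tadd.
Proof.
move=> k; elim/tens_ind=> s; elim/tens_ind=> t.
by rewrite !(taddE, tscaleE) map_cat.
Qed.
Fact tscale_Dl (x : tens) k l : tscale (k + l) x = tadd (tscale k x) (tscale l x).
Proof.
elim/tens_ind: x => s; rewrite !(taddE, tscaleE); apply/tclsP.
elim: s => [|[a b] s IH]; first exact: TRefl.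
apply: TSym.
apply: (TTrans (tcongr_catACA [:: tpair_scale k (a, b)] _ [:: tpair_scale l (a, b)] _)).
apply: TSym; apply: (@TCat [:: tpair_scale (k + l) (a, b)]) IH.
rewrite /tpair_scale /= scalerDl; exact: TDl.
Qed.

HB.instance Definition _ := GRing.Zmodule_isLmodule.Build K tens
  tscale_A tscale_1 tscale_Dr tscale_Dl.

Definition tpure (a : A) (b : B) : tens := tcls [:: (a, b)].

Lemma tcls_cat s t : tcls (s ++ t) = tcls s + tcls t.
Proof. by rewrite -taddE. Qed.

Lemma tcls_sum s : tcls s = \sum_(p <- s) tpure p.1 p.2.
Proof.
elim: s => [|[a b] s IH]; first by rewrite big_nil.
by rewrite big_cons -IH -cat1s tcls_cat.
Qed.

Lemma tensE (x : tens) : exists s, x = \sum_(p <- s) tpure p.1 p.2.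
Proof. by exists (trep x); rewrite -tcls_sum trepK. Qed.

Lemma tpureDl a a' b : tpure (a + a') b = tpure a b + tpure a' b.
Proof. by rewrite -tcls_cat; apply/tclsP; exact: TDl. Qed.
Lemma tpureDr a b b' : tpure a (b + b') = tpure a b + tpure a b'.
Proof. by rewrite -tcls_cat; apply/tclsP; exact: TDr. Qed.
Lemma tpureZl k a b : tpure (k *: a) b = k *: tpure a b.
Proof. by rewrite -[RHS]/(tscale _ _) tscaleE. Qed.
Lemma tpureZr k a b : tpure a (k *: b) = k *: tpure a b.
Proof. by rewrite -tpureZl; apply/tclsP; apply: TSym; exact: TZlr. Qed.

Lemma tcongr_bilinear (V : lmodType K) (f : A -> B -> V) :
  (forall k a a' b, f (k *: a + a') b = k *: f a b + f a' b) ->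
  (forall k a b b', f a (k *: b + b') = k *: f a b + f a b') ->
  forall s t, tcongr s t -> \sum_(p <- s) f p.1 p.2 = \sum_(p <- t) f p.1 p.2.
Proof.
move=> fl fr.
have fDl a a' b : f (a + a') b = f a b + f a' b by rewrite -[a]scale1r fl !scale1r.
have fDr a b b' : f a (b + b') = f a b + f a b' by rewrite -[b]scale1r fr !scale1r.
have f0l b : f 0 b = 0 by apply: (addrI (f 0 b)); rewrite -fDl !addr0.
have f0r a : f a 0 = 0 by apply: (addrI (f a 0)); rewrite -fDr !addr0.
have fZl k a b : f (k *: a) b = k *: f a b by rewrite -[k *: a]addr0 fl f0l addr0.
have fZr k a b : f a (k *: b) = k *: f a b by rewrite -[k *: b]addr0 fr f0r addr0.
move=> s t; elim=> {s t}.
- by [].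
- by move=> s t _ ->.
- by move=> s t u _ -> _ ->.
- by move=> s t s' t' _ h _ h'; rewrite !big_cat /= h h'.
- by move=> s t; rewrite !big_cat /= addrC.
- by move=> b; rewrite big_seq1 big_nil f0l.
- by move=> a a' b; rewrite big_seq1 big_cons big_seq1 fDl.
- by move=> a b b'; rewrite big_seq1 big_cons big_seq1 fDr.
- by move=> k a b; rewrite !big_seq1 fZl fZr.
Qed.

Fact tmul_A : associative tmul.
Proof.
elim/tens_ind=> s; elim/tens_ind=> t; elim/tens_ind=> u.
rewrite !tmulE; congr tcls.
elim: s => [|p s IH] //; rewrite !tlmul_cons tlmul_catl IH; congr cat.
elim: t {IH} => [|r t IH] //; rewrite tlmul_cons map_cat IH; congr cat.
by rewrite -map_comp; apply: eq_map => v; rewrite /tpair_mul /= !mulrA.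
Qed.
Fact tmul_1l : left_id (tpure 1 1) tmul.
Proof.
elim/tens_ind=> s; rewrite tmulE tlmul_cons cats0 -[in RHS](map_id s); congr tcls.
by apply: eq_map => -[a b]; rewrite /tpair_mul /= !mul1r.
Qed.
Fact tmul_1r : right_id (tpure 1 1) tmul.
Proof.
elim/tens_ind=> s; rewrite tmulE tlmul1 -[in RHS](map_id s); congr tcls.
by apply: eq_map => -[a b]; rewrite /tpair_mul /= !mulr1.
Qed.
Fact tmul_Dl : left_distributive tmul tadd.
Proof.
elim/tens_ind=> s; elim/tens_ind=> t; elim/tens_ind=> u.
by rewrite !(tmulE, taddE) tlmul_catl.
Qed.
Fact tmul_Dr : right_distributive tmul tadd.
Proof.
elim/tens_ind=> s; elim/tens_ind=> t; elim/tens_ind=> u.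
by rewrite !(tmulE, taddE); apply/tclsP; exact: tlmul_catr.
Qed.
Fact tone_neq0 : tpure 1 1 != 0.
Proof.
have [f [fl f1]] := separating_form (oner_neq0 A).
have [g [gl g1]] := separating_form (oner_neq0 B).
apply/eqP => /tclsP h.
have := @tcongr_bilinear K^o (fun a b => f a * g b) _ _ _ _ h.
rewrite big_seq1 big_nil /= => e.
suff /eqP : f 1 * g 1 = 0 by rewrite mulf_eq0 (negPf f1) (negPf g1).
apply: e => [k a a' b|k a b b'].
  by rewrite fl mulrDl; congr (_ + _); rewrite -scalerAl.
by rewrite gl mulrDr; congr (_ + _); rewrite -scalerAr.
Qed.

HB.instance Definition _ := GRing.Zmodule_isNzRing.Build tens
  tmul_A tmul_1l tmul_1r tmul_Dl tmul_Dr tone_neq0.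

Fact tscale_Al k (x y : tens) : tscale k (tmul x y) = tmul (tscale k x) y.
Proof.
elim/tens_ind: x => s; elim/tens_ind: y => t; rewrite !(tmulE, tscaleE); congr tcls.
elim: s => [|p s IH] //=; rewrite !tlmul_cons map_cat IH; congr cat.
by rewrite -map_comp; apply: eq_map => r; rewrite /tpair_scale/tpair_mul /= scalerAl.
Qed.
HB.instance Definition _ := GRing.Lmodule_isLalgebra.Build K tens tscale_Al.

Fact tscale_Ar k (x y : tens) : tscale k (tmul x y) = tmul x (tscale k y).
Proof.
elim/tens_ind: x => s; elim/tens_ind: y => t; rewrite !(tmulE, tscaleE); congr tcls.
elim: s => [|p s IH] //=; rewrite !tlmul_cons map_cat IH; congr cat.
rewrite -!map_comp; apply: eq_map => r.
by rewrite /tpair_scale/tpair_mul /= scalerAr.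
Qed.
HB.instance Definition _ := GRing.Lalgebra_isAlgebra.Build K tens tscale_Ar.

HB.instance Definition _ := GRing.NzRing_hasMulInverse.Build tens
  (@cmulVr tens) (@cmulrV tens) (@cunitrP tens) (@cinv_out tens).

Lemma tpure1 : tpure 1 1 = 1. Proof. by []. Qed.

Lemma tpureM a b a' b' : tpure a b * tpure a' b' = tpure (a * a') (b * b').
Proof. by rewrite -[LHS]/(tmul _ _) tmulE. Qed.

End Tensor.

Section TensorMap.
Variables (K : fieldType) (A B A' B' : algType K).
Variables (f : {lrmorphism A -> A'}) (g : {lrmorphism B -> B'}).

Definition tmap (x : tens A B) : tens A' B' :=
  \sum_(p <- trep x) tpure (f p.1) (g p.2).

Lemma tmap_cls s : tmap (tcls s) = \sum_(p <- s) tpure (f p.1) (g p.2).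
Proof.
rewrite /tmap.
apply: (@tcongr_bilinear K A B (tens A' B') (fun a b => tpure (f a) (g b)));
  last exact: tclsK.
- by move=> k a a' b; rewrite linearP tpureDl tpureZl.
- by move=> k a b b'; rewrite linearP tpureDr tpureZr.
Qed.

Lemma tmap_pure a b : tmap (tpure a b) = tpure (f a) (g b).
Proof. by rewrite tmap_cls big_seq1. Qed.

Lemma tmap_is_linear : linear tmap.
Proof.
move=> k; elim/tens_ind=> s; elim/tens_ind=> t.
rewrite -[k *: _]/(tscale _ _) tscaleE -tcls_cat !tmap_cls big_cat /= big_map.
rewrite scaler_sumr; congr (_ + _); apply: eq_bigr => p _ /=.
by rewrite linearZ /= tpureZl.
Qed.
HB.instance Definition _ :=
  GRing.isLinear.Build K (tens A B) (tens A' B') _ tmap tmap_is_linear.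

Lemma tmap_is_monoid_morphism : monoid_morphism tmap.
Proof.
split; first by rewrite -tpure1 tmap_pure !rmorph1.
move=> x y; have [s ->] := tensE x; have [t ->] := tensE y.
rewrite mulr_suml !raddf_sum mulr_suml; apply: eq_bigr => p _.
rewrite mulr_sumr !raddf_sum mulr_sumr; apply: eq_bigr => r _.
by rewrite /= tpureM !tmap_pure tpureM !rmorphM.
Qed.
HB.instance Definition _ :=
  GRing.isMonoidMorphism.Build (tens A B) (tens A' B') tmap tmap_is_monoid_morphism.

End TensorMap.

Section AlgAut.
Variables (K : fieldType) (A : algType K).

Definition is_alg_aut (f : A -> A) : Prop :=
  [/\ linear f, monoid_morphism f & bijective f].

Record algAut := AlgAut { autf :> A -> A; autP : is_alg_aut autf }.

HB.instance Definition _ := gen_eqMixin algAut.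
HB.instance Definition _ := gen_choiceMixin algAut.

Lemma algAut_ext (f g : algAut) : f =1 g -> f = g.
Proof.
case: f g => [f fP] [g gP] /= /funext fg; move: gP; rewrite -fg => gP.
by congr AlgAut; exact: Prop_irrelevance.
Qed.

Lemma autf_is_linear (f : algAut) : linear f.
Proof. by case: (autP f). Qed.
HB.instance Definition _ (f : algAut) :=
  GRing.isLinear.Build K A A _ (autf f) (autf_is_linear f).

Lemma autf_is_monoid_morphism (f : algAut) : monoid_morphism f.
Proof. by case: (autP f). Qed.
HB.instance Definition _ (f : algAut) :=
  GRing.isMonoidMorphism.Build A A (autf f) (autf_is_monoid_morphism f).

Fact aut1P : is_alg_aut id.
Proof. by split=> //; exists id. Qed.

Definition aut1 : algAut := AlgAut aut1P.

Fact autMP (f g : algAut) : is_alg_aut (fun x => f (g x)).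
Proof.
split.
- by move=> k x y; rewrite !linearP.
- by split=> [|x y]; rewrite ?rmorph1 ?rmorphM.
- have [_ _ fb] := autP f; have [_ _ gb] := autP g.
  exact: (bij_comp fb gb).
Qed.

Definition autM (f g : algAut) : algAut := AlgAut (autMP f g).

Fact aut_inv_ex (f : algAut) : exists g : algAut, cancel f g /\ cancel g f.
Proof.
have [_ _ [g fK gK]] := autP f.
have gP : is_alg_aut g.
  split; last by exists f.
  - move=> k x y; apply: (can_inj fK); rewrite [RHS]linearP.
    by apply: (etrans (gK _)); congr (_ *: _ + _); apply/esym; exact: gK.
  - split=> [|x y]; apply: (can_inj fK); first by rewrite gK rmorph1.
    by rewrite [RHS]rmorphM; apply: (etrans (gK _)); congr (_ * _); apply/esym; exact: gK.
by exists (AlgAut gP).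
Qed.

Definition autV (f : algAut) : algAut := projT1 (cid (aut_inv_ex f)).

Lemma autVK (f : algAut) : cancel f (autV f).
Proof. by case: (projT2 (cid (aut_inv_ex f))). Qed.
Lemma autKV (f : algAut) : cancel (autV f) f.
Proof. by case: (projT2 (cid (aut_inv_ex f))). Qed.

Fact autA : associative autM.
Proof. by move=> f g h; apply: algAut_ext. Qed.
Fact aut1M : left_id aut1 autM.
Proof. by move=> f; apply: algAut_ext. Qed.
Fact autM1 : right_id aut1 autM.
Proof. by move=> f; apply: algAut_ext. Qed.
Fact autVM : left_inverse aut1 autV autM.
Proof. by move=> f; apply: algAut_ext; exact: autVK. Qed.
Fact autMV : right_inverse aut1 autV autM.
Proof. by move=> f; apply: algAut_ext; exact: autKV. Qed.

HB.instance Definition _ := isGroup.Build algAut autA aut1M autM1 autVM autMV.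

Lemma autME (f g : algAut) x : (f * g)%g x = f (g x). Proof. by []. Qed.

(* Compatibility with the antipode is automatic for a bialgebra morphism
   between Hopf algebras. *)
Definition hopfAut (Delta : {lrmorphism A -> tens A A})
    (eps : {lrmorphism A -> K^o}) : set algAut :=
  [set phi : algAut | (forall x, Delta (phi x) = tmap phi phi (Delta x)) /\
                      (forall x, eps (phi x) = eps x)]%classic.

End AlgAut.

Section Kstar.
Variable K : fieldType.

Definition Kstar := {x : K | x != 0}.
HB.instance Definition _ := Choice.on Kstar.

Fact Kstar1P : (1 : K) != 0. Proof. exact: oner_neq0. Qed.
Fact KstarMP (x y : Kstar) : sval x * sval y != 0.
Proof. exact: (mulf_neq0 (svalP x) (svalP y)). Qed.
Fact KstarVP (x : Kstar) : (sval x)^-1 != 0.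
Proof. by rewrite invr_neq0 ?(svalP x). Qed.

Definition Kstar1 : Kstar := exist _ 1 Kstar1P.
Definition KstarM (x y : Kstar) : Kstar := exist _ (sval x * sval y) (KstarMP x y).
Definition KstarV (x : Kstar) : Kstar := exist _ (sval x)^-1 (KstarVP x).

Fact Kstar_A : associative KstarM.
Proof. by move=> x y z; apply: val_inj => /=; rewrite mulrA. Qed.
Fact Kstar_1M : left_id Kstar1 KstarM.
Proof. by move=> x; apply: val_inj => /=; rewrite mul1r. Qed.
Fact Kstar_M1 : right_id Kstar1 KstarM.
Proof. by move=> x; apply: val_inj => /=; rewrite mulr1. Qed.
Fact Kstar_VM : left_inverse Kstar1 KstarV KstarM.
Proof. by move=> x; apply: val_inj => /=; rewrite mulVf ?(svalP x). Qed.
Fact Kstar_MV : right_inverse Kstar1 KstarV KstarM.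
Proof. by move=> x; apply: val_inj => /=; rewrite divff ?(svalP x). Qed.

HB.instance Definition _ :=
  isGroup.Build Kstar Kstar_A Kstar_1M Kstar_M1 Kstar_VM Kstar_MV.

End Kstar.

Inductive Tgen := t11 | t12 | t22.

Section QuantumTriangular.
Variables (K : fieldType) (q : K).

Inductive T_rel : pterm K Tgen -> pterm K Tgen -> Prop :=
  | TR2212 : T_rel (TMul (Gen t22) (Gen t12)) (TScale q (TMul (Gen t12) (Gen t22)))
  | TR1112 : T_rel (TMul (Gen t11) (Gen t12)) (TScale q (TMul (Gen t12) (Gen t11)))
  | TR1122 : T_rel (TMul (Gen t11) (Gen t22)) (TMul (Gen t22) (Gen t11)).

Definition Tfun (R : Type) (x11 x12 x22 : R) (g : Tgen) : R :=
  match g with t11 => x11 | t12 => x12 | t22 => x22 end.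

Lemma T_respects (B : algType K) (x11 x12 x22 : B) :
  x22 * x12 = q *: (x12 * x22) -> x11 * x12 = q *: (x12 * x11) ->
  x11 * x22 = x22 * x11 -> respects T_rel (Tfun x11 x12 x22).
Proof. by move=> h1 h2 h3 s t []. Qed.

Fact eps_respects : respects T_rel (Tfun (1 : K^o) 0 1).
Proof. by apply: T_respects; rewrite ?mulr0 ?mul0r ?scaler0. Qed.

Definition Tq : Type := presAlg (respects_nontriv eps_respects).
HB.instance Definition _ := GRing.UnitAlgebra.on Tq.

Definition Tq_gen (g : Tgen) : Tq := pgen (respects_nontriv eps_respects) g.

Definition Tq_eps : {lrmorphism Tq -> K^o} := plift eps_respects.

Lemma Tq_eps_gen g : Tq_eps (Tq_gen g) = Tfun (1 : K^o) 0 1 g.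
Proof. exact: plift_gen. Qed.

Definition Tq_S : Tq -> Prop :=
  mulset (fun x => x = Tq_gen t11 \/ x = Tq_gen t22).

Fact Tq_eps_unit x : Tq_S x -> Tq_eps x \is a GRing.unit.
Proof.
apply: mulset_unit => {}x; rewrite -[X in _ -> X \is a _]/(Tq_eps x) => -[] ->;
by rewrite Tq_eps_gen /= unitr1.
Qed.

Definition UTq_nontriv : ~ pcongr (loc_rel Tq_S) TZero TOne :=
  respects_nontriv (loc_respects Tq_eps_unit).

Definition UTq : Type := loc UTq_nontriv.
HB.instance Definition _ := GRing.UnitAlgebra.on UTq.

Definition a11 : UTq := to_loc UTq_nontriv (Tq_gen t11).
Definition a12 : UTq := to_loc UTq_nontriv (Tq_gen t12).
Definition a22 : UTq := to_loc UTq_nontriv (Tq_gen t22).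

Lemma a2212 : a22 * a12 = q *: (a12 * a22).
Proof.
rewrite -!rmorphM -linearZ /=; congr to_loc.
by rewrite /Tq_gen /pgen -!pclsM -?pclsZ; apply: pcls_rel; exact: TR2212.
Qed.
Lemma a1112 : a11 * a12 = q *: (a12 * a11).
Proof.
rewrite -!rmorphM -linearZ /=; congr to_loc.
by rewrite /Tq_gen /pgen -!pclsM -?pclsZ; apply: pcls_rel; exact: TR1112.
Qed.
Lemma a1122 : a11 * a22 = a22 * a11.
Proof.
rewrite -!rmorphM /=; congr to_loc.
by rewrite /Tq_gen /pgen -!pclsM -?pclsZ; apply: pcls_rel; exact: TR1122.
Qed.
Lemma a11_unit : a11 \is a GRing.unit.
Proof. by apply: to_loc_unit; apply: MSgen; left. Qed.
Lemma a22_unit : a22 \is a GRing.unit.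
Proof. by apply: to_loc_unit; apply: MSgen; right. Qed.

Definition UTq_eps : {lrmorphism UTq -> K^o} := plift (loc_respects Tq_eps_unit).

Lemma UTq_eps_loc x : UTq_eps (to_loc UTq_nontriv x) = Tq_eps x.
Proof. exact: plift_gen. Qed.

Fact Delta_respects : respects T_rel
  (Tfun (tpure a11 a11) (tpure a11 a12 + tpure a12 a22) (tpure a22 a22)).
Proof.
apply: T_respects.
- rewrite mulrDr mulrDl !tpureM a2212 !tpureZl !tpureZr -a1122 scalerDr.
  by congr (_ + _).
- by rewrite mulrDr mulrDl !tpureM a1112 a1122 !tpureZl !tpureZr scalerDr.
- by rewrite !tpureM a1122.
Qed.

Definition Tq_Delta : {lrmorphism Tq -> tens UTq UTq} := plift Delta_respects.

Lemma Tq_Delta_gen g : Tq_Delta (Tq_gen g) =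
  Tfun (tpure a11 a11) (tpure a11 a12 + tpure a12 a22) (tpure a22 a22) g.
Proof. exact: plift_gen. Qed.

Lemma tpure_unit (x y : UTq) : x \is a GRing.unit -> y \is a GRing.unit ->
  tpure x y \is a GRing.unit.
Proof.
move=> ux uy; apply/unitrP; exists (tpure x^-1 y^-1).
by rewrite !tpureM !mulVr ?mulrV.
Qed.

Fact Tq_Delta_unit x : Tq_S x -> Tq_Delta x \is a GRing.unit.
Proof.
apply: mulset_unit => {}x; rewrite -[X in _ -> X \is a _]/(Tq_Delta x) => -[] ->;
rewrite Tq_Delta_gen /=;
by apply: tpure_unit; rewrite ?a11_unit ?a22_unit.
Qed.

Definition UTq_Delta : {lrmorphism UTq -> tens UTq UTq} :=
  plift (loc_respects Tq_Delta_unit).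

Lemma UTq_Delta_loc x : UTq_Delta (to_loc UTq_nontriv x) = Tq_Delta x.
Proof. exact: plift_gen. Qed.

Lemma Delta_a11 : UTq_Delta a11 = tpure a11 a11.
Proof. by rewrite UTq_Delta_loc Tq_Delta_gen. Qed.
Lemma Delta_a22 : UTq_Delta a22 = tpure a22 a22.
Proof. by rewrite UTq_Delta_loc Tq_Delta_gen. Qed.
Lemma Delta_a12 : UTq_Delta a12 = tpure a11 a12 + tpure a12 a22.
Proof. by rewrite UTq_Delta_loc Tq_Delta_gen. Qed.

Lemma eps_a11 : UTq_eps a11 = 1.
Proof. by rewrite UTq_eps_loc Tq_eps_gen. Qed.
Lemma eps_a22 : UTq_eps a22 = 1.
Proof. by rewrite UTq_eps_loc Tq_eps_gen. Qed.
Lemma eps_a12 : UTq_eps a12 = 0.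
Proof. by rewrite UTq_eps_loc Tq_eps_gen. Qed.

End QuantumTriangular.

(* Main.v *)
(* The monomials a11^i a22^j a12^n (i, j integers, n natural) form a basis: they
   span because their span absorbs the generators, and they are independent
   because the left regular representation exists as an action by weighted shifts
   on functions of (i, j, n).  Since a12 |-> q a12 is a Hopf automorphism and q is
   not a root of unity, the degree in a12 is additive under Delta; hence a
   group-like element has degree 0 and is a monomial a11^i a22^j.
   Let phi be a Hopf automorphism, g, h, y the images of a11, a22, a12.  Then g and
   h are such monomials, and g y = q y g forces y to have degree 1 and g to have
   i + j = 1.  Comparing coefficients in Delta y = g (x) y + y (x) h, every monomial
   a11^u a22^v a12 of y satisfies g = a11^(u+1) a22^v and h = a11^u a22^(v+1), so
   there is only one and v = -u. *)

Require Import Defs.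
From HB Require Import structures.
From mathcomp Require Import all_boot all_order all_algebra.
From mathcomp Require Import boolp classical_sets functions.

Set Implicit Arguments.
Unset Strict Implicit.
Unset Printing Implicit Defensive.

Import GRing.Theory.
Local Open Scope ring_scope.
Local Open Scope classical_set_scope.

(** * The endomorphism algebra of a nonzero vector space *)

Section LinearEndomorphisms.
Variables (K : fieldType) (V : lmodType K) (v : V).

(** The proof that [v] is nonzero indexes the type because algebras here are nontrivial rings; it is
    what yields [lend1_neq0]. *)
Record linEnd (v_neq0 : v != 0) := LinEnd { lend :> V -> V; lend_linear : linear lend }.

Variable v_neq0 : v != 0.
Local Notation E := (linEnd v_neq0).

HB.instance Definition _ := gen_eqMixin E.
HB.instance Definition _ := gen_choiceMixin E.

Lemma linEnd_ext (f g : E) : f =1 g -> f = g.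
Proof.
case: f g => [f fP] [g gP] /= /funext fg; move: gP; rewrite -fg => gP.
by congr LinEnd; exact: Prop_irrelevance.
Qed.

HB.instance Definition _ (f : E) :=
  GRing.isLinear.Build K V V _ (lend f) (lend_linear f).

Fact lend0_linear : linear (fun _ : V => 0 : V).
Proof. by move=> k x y; rewrite scaler0 addr0. Qed.
Fact lend1_linear : linear (fun x : V => x).
Proof. by []. Qed.
Fact lendN_linear (f : E) : linear (fun x => - f x).
Proof. by move=> k x y; rewrite linearP opprD scalerN. Qed.
Fact lendD_linear (f g : E) : linear (fun x => f x + g x).
Proof. by move=> k x y; rewrite !linearP scalerDr addrACA. Qed.
Fact lendM_linear (f g : E) : linear (fun x => f (g x)).
Proof. by move=> k x y; rewrite !linearP. Qed.
Fact lendZ_linear c (f : E) : linear (fun x => c *: f x).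
Proof. by move=> k x y; rewrite linearP scalerDr !scalerA mulrC. Qed.

Let lend0 : E := LinEnd v_neq0 lend0_linear.
Let lend1 : E := LinEnd v_neq0 lend1_linear.
Let lendN f : E := LinEnd v_neq0 (lendN_linear f).
Let lendD f g : E := LinEnd v_neq0 (lendD_linear f g).
Let lendM f g : E := LinEnd v_neq0 (lendM_linear f g).
Let lendZ c f : E := LinEnd v_neq0 (lendZ_linear c f).

Fact lendDA : associative lendD.
Proof. by move=> f g h; apply: linEnd_ext => x; exact: addrA. Qed.
Fact lendDC : commutative lendD.
Proof. by move=> f g; apply: linEnd_ext => x; exact: addrC. Qed.
Fact lend0D : left_id lend0 lendD.
Proof. by move=> f; apply: linEnd_ext => x; exact: add0r. Qed.
Fact lendND : left_inverse lend0 lendN lendD.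
Proof. by move=> f; apply: linEnd_ext => x; exact: addNr. Qed.

HB.instance Definition _ := GRing.isZmodule.Build E lendDA lendDC lend0D lendND.

Fact lendMA : associative lendM.
Proof. by move=> f g h; exact: linEnd_ext. Qed.
Fact lend1M : left_id lend1 lendM.
Proof. by move=> f; exact: linEnd_ext. Qed.
Fact lendM1 : right_id lend1 lendM.
Proof. by move=> f; exact: linEnd_ext. Qed.
Fact lendMDl : left_distributive lendM lendD.
Proof. by move=> f g h; exact: linEnd_ext. Qed.
Fact lendMDr : right_distributive lendM lendD.
Proof. by move=> f g h; apply: linEnd_ext => x; exact: linearD. Qed.
Fact lend1_neq0 : lend1 != 0.
Proof.
apply/eqP => /(congr1 (fun f : E => f v)) /= v0.
by move: v_neq0; rewrite v0 eqxx.
Qed.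

HB.instance Definition _ := GRing.Zmodule_isNzRing.Build E
  lendMA lend1M lendM1 lendMDl lendMDr lend1_neq0.

Fact lendZA k l f : lendZ k (lendZ l f) = lendZ (k * l) f.
Proof. by apply: linEnd_ext => x; exact: scalerA. Qed.
Fact lend1Z : left_id 1 lendZ.
Proof. by move=> f; apply: linEnd_ext => x; exact: scale1r. Qed.
Fact lendZDr : right_distributive lendZ lendD.
Proof. by move=> k f g; apply: linEnd_ext => x; exact: scalerDr. Qed.
Fact lendZDl f k l : lendZ (k + l) f = lendD (lendZ k f) (lendZ l f).
Proof. by apply: linEnd_ext => x; exact: scalerDl. Qed.

HB.instance Definition _ := GRing.Zmodule_isLmodule.Build K E
  lendZA lend1Z lendZDr lendZDl.

Fact lendZAl k (f g : E) : k *: (f * g) = k *: f * g.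
Proof. exact: linEnd_ext. Qed.
HB.instance Definition _ := GRing.Lmodule_isLalgebra.Build K E lendZAl.

Fact lendZAr k (f g : E) : k *: (f * g) = f * (k *: g).
Proof. by apply: linEnd_ext => x; rewrite /= -[RHS]/(f (k *: g x)) linearZ. Qed.
HB.instance Definition _ := GRing.Lalgebra_isAlgebra.Build K E lendZAr.

HB.instance Definition _ := GRing.NzRing_hasMulInverse.Build E
  (@cmulVr E) (@cmulrV E) (@cunitrP E) (@cinv_out E).

Lemma lendME (f g : E) x : (f * g) x = f (g x). Proof. by []. Qed.
Lemma lendZE k (f : E) x : (k *: f) x = k *: f x. Proof. by []. Qed.

End LinearEndomorphisms.

(** * Morphisms out of the localized algebra, and its generators *)

Section UniversalProperty.
Variables (K : fieldType) (q : K).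
Local Notation A := (UTq q).
Local Notation a11 := (a11 q).
Local Notation a12 := (a12 q).
Local Notation a22 := (a22 q).

(** The relations give a morphism on [Tq]; as it inverts both generators of the multiplicative set,
    it inverts the whole set and so extends to the localization. *)
Lemma UTq_lift (B : unitAlgType K) (x11 x12 x22 : B) :
  x22 * x12 = q *: (x12 * x22) -> x11 * x12 = q *: (x12 * x11) ->
  x11 * x22 = x22 * x11 -> x11 \is a GRing.unit -> x22 \is a GRing.unit ->
  exists F : {lrmorphism A -> B}, [/\ F a11 = x11, F a12 = x12 & F a22 = x22].
Proof.
move=> r2212 r1112 r1122 u11 u22.
pose G : {lrmorphism Tq q -> B} := plift (T_respects r2212 r1112 r1122).
have Ggen g : G (Tq_gen q g) = Tfun x11 x12 x22 g by exact: plift_gen.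
have Gunit s : Tq_S s -> G s \is a GRing.unit.
  apply: mulset_unit => x; rewrite -[X in _ -> X \is a _]/(G x).
  by case=> ->; rewrite Ggen.
exists (plift (loc_respects Gunit)).
by split; apply: (etrans (plift_gen _ _ _)); exact: Ggen.
Qed.

(** Two nested inductions on terms: first for the image of [Tq], then for the localization built
    over it. *)
Lemma UTq_gen_ind (P : A -> Prop) :
  P 1 -> (forall k x, P x -> P (k *: x)) ->
  (forall x y, P x -> P y -> P (x + y)) ->
  (forall x y, P x -> P y -> P (x * y)) ->
  P a11 -> P a12 -> P a22 -> P a11^-1 -> P a22^-1 -> forall x, P x.
Proof.
move=> P1 PZ PD PM P11 P12 P22 P11V P22V.
have P0 : P 0 by rewrite -(scale0r 1); exact: PZ.
have PN x : P x -> P (- x) by rewrite -scaleN1r; exact: PZ.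
have PT (a : Tq q) : P (to_loc (@UTq_nontriv K q) a).
  elim/presAlg_ind: a; elim=> [[]||| s Ps | s Ps t Pt | k s Ps | s Ps t Pt] //.
  - by rewrite pcls0 raddf0.
  - by rewrite pcls1 rmorph1.
  - by rewrite pclsN raddfN; exact: PN.
  - by rewrite pclsD raddfD; exact: PD.
  - by rewrite pclsZ linearZ; exact: PZ.
  - by rewrite pclsM rmorphM; exact: PM.
elim/presAlg_ind; elim=> [[a|[s Ss]]||| s Ps | s Ps t Pt | k s Ps | s Ps t Pt] //.
- exact: PT.
(* A formal inverse is the true inverse, and the inverse of a product is a product of inverses, so
   those of [a11] and [a22] suffice. *)
- have -> : pcls (@UTq_nontriv K q) (Gen (inr (exist _ s Ss))) =
            (to_loc (@UTq_nontriv K q) s)^-1.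
    apply: (mulrI (to_loc_unit (@UTq_nontriv K q) Ss)).
    rewrite divrr ?to_loc_unit // -pcls1.
    by rewrite -(pcls_rel _ (LRinvr (exist _ s Ss))) pclsM.
  elim: Ss => [|x [] -> |x y Sx Px Sy Py] //; first by rewrite rmorph1 invr1.
  by rewrite rmorphM invrM ?to_loc_unit //; exact: PM.
- by rewrite pclsN; exact: PN.
- by rewrite pclsD; exact: PD.
- by rewrite pclsZ; exact: PZ.
- by rewrite pclsM; exact: PM.
Qed.

Lemma UTq_hom_ext (B : unitAlgType K) (F G : {lrmorphism A -> B}) :
  F a11 = G a11 -> F a12 = G a12 -> F a22 = G a22 -> F =1 G.
Proof.
move=> e11 e12 e22; apply: UTq_gen_ind => //.
- by rewrite !rmorph1.
- by move=> k x e; rewrite !linearZ /= e.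
- by move=> x y ex ey; rewrite !raddfD /= ex ey.
- by move=> x y ex ey; rewrite !rmorphM /= ex ey.
- by rewrite !rmorphV ?a11_unit //= e11.
- by rewrite !rmorphV ?a22_unit //= e22.
Qed.

End UniversalProperty.

(** Negative exponents reduce to natural ones, since [x^-1] commutes with [y] up to the factor
    [k^-1]. *)
Lemma qcommXz (K : fieldType) (B : unitAlgType K) (k : K) (x y : B) (i : int) :
  k != 0 -> x \is a GRing.unit -> x * y = k *: (y * x) ->
  x ^ i * y = k ^ i *: (y * x ^ i).
Proof.
move=> k0 ux xy.
have qcommXn c (w : B) n : w * y = c *: (y * w) -> w ^+ n * y = c ^+ n *: (y * w ^+ n).
  move=> wy; elim: n => [|n IH]; first by rewrite !expr0 scale1r mul1r mulr1.
  by rewrite [w ^+ _]exprSr -mulrA wy -scalerAr [in LHS]mulrA IH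
    -scalerAl scalerA -exprS -mulrA.
case: i => n; first exact: qcommXn.
rewrite NegzE -!exprz_inv; apply: qcommXn; apply: (mulrI ux).
rewrite mulrA divrr // mul1r -scalerAr mulrA xy.
by rewrite -scalerAl scalerA mulVf // scale1r -mulrA divrr // mulr1.
Qed.

(** * The monomials span *)

Section Monomials.
Variables (K : fieldType) (q : K) (q_neq0 : q != 0).
Local Notation A := (UTq q).
Local Notation a11 := (a11 q).
Local Notation a12 := (a12 q).
Local Notation a22 := (a22 q).

Definition torus (i j : int) : A := a11 ^ i * a22 ^ j.

Lemma torus_unit i j : torus i j \is a GRing.unit.
Proof. by rewrite unitrMl rpredXz ?a11_unit ?a22_unit. Qed.

Lemma torusM i j k l : torus i j * torus k l = torus (i + k) (j + l).
Proof.
rewrite /torus !exprzDr ?a11_unit ?a22_unit // !mulrA; congr (_ * _).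
rewrite -!mulrA; congr (_ * _).
by apply/commrXz/commr_sym/commrXz; exact: a1122.
Qed.

Lemma torus00 : torus 0 0 = 1. Proof. by rewrite /torus mulr1. Qed.
Lemma torus10 : torus 1 0 = a11. Proof. by rewrite /torus mulr1. Qed.
Lemma torus01 : torus 0 1 = a22. Proof. by rewrite /torus mul1r. Qed.

Lemma torusV i j : (torus i j)^-1 = torus (- i) (- j).
Proof.
by apply: (mulrI (torus_unit i j)); rewrite divrr ?torus_unit // torusM !subrr torus00.
Qed.

Lemma torusXz i j k : torus i j ^ k = torus (i * k) (j * k).
Proof.
elim/int_rect: k => [|n IH|n IH]; first by rewrite !mulr0 torus00.
  by rewrite exprSz IH torusM -addn1 PoszD !mulrDr !mulr1 addrC [in j + _]addrC.
rewrite -addn1 PoszD opprD exprzDr ?torus_unit // IH -exprnN expr1 torusV torusM.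
by rewrite !mulrDr !mulrN1.
Qed.

(** Both diagonal generators pass [a12] with the same factor [q], so only the sum of the exponents
    counts. *)
Lemma torus_a12 i j : torus i j * a12 = q ^ (i + j) *: (a12 * torus i j).
Proof.
rewrite /torus -mulrA (qcommXz _ q_neq0 (a22_unit q) (a2212 q)) -scalerAr mulrA.
rewrite (qcommXz _ q_neq0 (a11_unit q) (a1112 q)) -scalerAl scalerA -mulrA.
by rewrite mulrC -expfzDr.
Qed.

Lemma torus_a12X i j n :
  torus i j * a12 ^+ n = q ^ ((i + j) * n%:Z) *: (a12 ^+ n * torus i j).
Proof.
elim: n => [|n IH]; first by rewrite mulr0 expr0z scale1r !expr0 mul1r mulr1.
rewrite [in LHS]exprSr mulrA IH -scalerAl -mulrA torus_a12.
rewrite -scalerAr scalerA mulrA -exprSr.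
by rewrite -expfzDr // -addn1 PoszD mulrDr mulr1.
Qed.

Definition mono (m : int * int * nat) : A := torus m.1.1 m.1.2 * a12 ^+ m.2.

Lemma mono_torus i j : mono (i, j, 0%N) = torus i j.
Proof. by rewrite /mono mulr1. Qed.

Lemma torus_mono i j k l n : torus i j * mono (k, l, n) = mono (i + k, j + l, n).
Proof. by rewrite /mono /= mulrA torusM. Qed.

Lemma mono_mulr_torus i j k l n :
  mono (k, l, n) * torus i j = (q ^ ((i + j) * n%:Z))^-1 *: mono (i + k, j + l, n).
Proof.
rewrite /mono /= [i + k]addrC [j + l]addrC -torusM -2!(mulrA (torus k l)).
rewrite torus_a12X -scalerAr.
by rewrite scalerA mulVf ?scale1r // expfz_neq0.
Qed.

Lemma a12_mono k l n :
  a12 * mono (k, l, n) = (q ^ (k + l))^-1 *: mono (k, l, n.+1).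
Proof.
rewrite /mono /= exprS (mulrA a12) (mulrA (torus k l)) torus_a12 -scalerAl scalerA.
by rewrite mulVf ?scale1r // expfz_neq0.
Qed.

Lemma UTq_mono_ind (P : A -> Prop) :
  P 0 -> (forall k m x, P x -> P (k *: mono m + x)) -> forall x, P x.
Proof.
move=> P0 PS.
pose W (x : A) := exists s : seq (K * (int * int * nat)),
    x = \sum_(p <- s) p.1 *: mono p.2.
suff WT : forall x, W x.
  move=> x; have [s ->] := WT x.
  by elim: s => [|p s IH]; rewrite ?big_nil // big_cons; exact: PS.
have W0 : W 0 by exists [::]; rewrite big_nil.
have WD x y : W x -> W y -> W (x + y).
  by move=> [s ->] [t ->]; exists (s ++ t); rewrite big_cat.
have WZ k x : W x -> W (k *: x).
  move=> [s ->]; exists [seq (k * p.1, p.2) | p <- s].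
  by rewrite big_map scaler_sumr; apply: eq_bigr => p _; rewrite scalerA.
have Wmono m : W (mono m) by exists [:: (1, m)]; rewrite big_seq1 scale1r.
have Wmul a : (forall m, W (a * mono m)) -> forall x, W x -> W (a * x).
  move=> h x [s ->]; rewrite mulr_sumr; elim: s => [|p s IH].
    by rewrite big_nil.
  by rewrite big_cons -scalerAr; apply: (WD) IH; apply: WZ.
have Wtorus i j x : W x -> W (torus i j * x).
  by apply: Wmul => -[[k l] n]; rewrite torus_mono.
(* The claim is strengthened from [x * 1] to [x * y] for all [y] in the span, so that the induction
   on [x] goes through products. *)
move=> x; rewrite -[x]mulr1; suff: forall y, W y -> W (x * y).
  by apply; rewrite -torus00 -mono_torus.
elim/UTq_gen_ind: x => [y|k x Wx y Wy|x y Wx Wy z Wz|x y Wx Wy z Wz|||||].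
- by rewrite mul1r.
- by rewrite -scalerAl; apply/WZ/Wx.
- by rewrite mulrDl; apply: WD; [exact: Wx | exact: Wy].
- by rewrite -mulrA; apply/Wx/Wy.
- by rewrite -torus10; exact: Wtorus.
- by apply: Wmul => -[[k l] n]; rewrite a12_mono; exact: WZ.
- by rewrite -torus01; exact: Wtorus.
- by rewrite -torus10 torusV; exact: Wtorus.
- by rewrite -torus01 torusV; exact: Wtorus.
Qed.

End Monomials.

(** * Linear independence of the monomials, and coordinates on the algebra and its tensor square *)

Section Coefficients.
Variables (K : fieldType) (q : K) (q_neq0 : q != 0).
Local Notation A := (UTq q).
Local Notation a11 := (a11 q).
Local Notation a12 := (a12 q).
Local Notation a22 := (a22 q).
Local Notation mono := (mono q).
Local Notation I := (int * int * nat)%type.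
Local Notation V := (I -> K^o).

(** The coefficient family of [1]. *)
Definition dirac0 : V := fun m => (m == (0, 0, 0%N))%:R.

Fact dirac0_neq0 : dirac0 != 0.
Proof.
apply/eqP => /(congr1 (fun f : V => f (0, 0, 0%N))) /eqP.
by rewrite /dirac0 eqxx (negPf (oner_neq0 _)).
Qed.

Fact wshift_linear (w : I -> K) (h : I -> I) :
  linear (fun (f : V) m => w m * f (h m) : K^o).
Proof.
move=> k f g; apply/funext => m.
by rewrite -[LHS]/(w m * (k * f (h m) + g (h m))) mulrDr mulrCA.
Qed.

Let wshift w h := LinEnd dirac0_neq0 (wshift_linear w h).

(* The operators by which left multiplication by a generator acts on the family of
   coefficients with respect to [mono]; the weight in [E12] comes from
   a12 a11^i a22^j = q^-(i+j) a11^i a22^j a12. *)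
Let E11 := wshift (fun=> 1) (fun m => (m.1.1 - 1, m.1.2, m.2)).
Let E22 := wshift (fun=> 1) (fun m => (m.1.1, m.1.2 - 1, m.2)).
Let E12 := wshift (fun m => if m.2 is 0 then 0 else (q ^ (m.1.1 + m.1.2))^-1)
                  (fun m => (m.1.1, m.1.2, m.2.-1)).

Let wshift_unit h h' : cancel h h' -> cancel h' h ->
  wshift (fun=> 1) h \is a GRing.unit.
Proof.
move=> hK h'K; apply/unitrP; exists (wshift (fun=> 1) h').
by split; apply: linEnd_ext => f; apply/funext => m; rewrite lendME /= !mul1r ?hK ?h'K.
Qed.

(** Lowering a torus exponent by one multiplies the weight of [E12] by [q], which is the commutation
    rule of the shifts. *)
Let qV (x : int) : (q ^ (x - 1))^-1 = q * (q ^ x)^-1.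
Proof. by rewrite expfzDr // invfM exprN1 invrK mulrC. Qed.

Fact regular_rep_ex : exists F : {lrmorphism A -> linEnd dirac0_neq0},
  [/\ F a11 = E11, F a12 = E12 & F a22 = E22].
Proof.
apply: UTq_lift.
- apply: linEnd_ext => f; apply/funext => -[[i j] n]; rewrite lendZE !lendME.
  rewrite -[RHS]/(q * _) /= !mul1r; case: n => [|n]; rewrite ?mul0r ?mulr0 //.
  by rewrite addrA qV mulrA.
- apply: linEnd_ext => f; apply/funext => -[[i j] n]; rewrite lendZE !lendME.
  rewrite -[RHS]/(q * _) /= !mul1r; case: n => [|n]; rewrite ?mul0r ?mulr0 //.
  by rewrite addrAC qV mulrA.
- apply: linEnd_ext => f; apply/funext => -[[i j] n]; rewrite !lendME.
  by rewrite /= !mul1r.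
- apply: (@wshift_unit _ (fun m => (m.1.1 + 1, m.1.2, m.2))) => -[[i j] n] /=.
    by rewrite subrK.
  by rewrite addrK.
- apply: (@wshift_unit _ (fun m => (m.1.1, m.1.2 + 1, m.2))) => -[[i j] n] /=.
    by rewrite subrK.
  by rewrite addrK.
Qed.

Definition regular_rep := projT1 (cid regular_rep_ex).

Fact regular_repE :
  [/\ regular_rep a11 = E11, regular_rep a12 = E12 & regular_rep a22 = E22].
Proof. exact: projT2 (cid regular_rep_ex). Qed.

(** Acting by [x] on the family of [1] produces the family of [x], whose entry at [m] is the
    coefficient of [mono m]. *)
Definition mcoef (m : I) (x : A) : K := regular_rep x dirac0 m.

Fact mcoef_linear m : linear (mcoef m : A -> K^o).
Proof. by move=> k x y; rewrite /mcoef linearP. Qed.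
HB.instance Definition _ m :=
  GRing.isLinear.Build K A K^o _ (mcoef m) (mcoef_linear m).

Lemma mcoefP m k x y : mcoef m (k *: x + y) = k * mcoef m x + mcoef m y.
Proof. exact: linearP. Qed.

Lemma mcoefZ m k x : mcoef m (k *: x) = k * mcoef m x.
Proof. exact: linearZ. Qed.

Let mcoef_a11 i j n x : mcoef (i + 1, j, n) (a11 * x) = mcoef (i, j, n) x.
Proof.
rewrite /mcoef rmorphM /=; case: regular_repE => -> _ _.
by rewrite /= mul1r addrK.
Qed.

Let mcoef_a22 i j n x : mcoef (i, j + 1, n) (a22 * x) = mcoef (i, j, n) x.
Proof.
rewrite /mcoef rmorphM /=; case: regular_repE => _ _ ->.
by rewrite /= mul1r addrK.
Qed.

Let mcoef_a12 i j n x :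
  mcoef (i, j, n.+1) (a12 * x) = (q ^ (i + j))^-1 * mcoef (i, j, n) x.
Proof.
rewrite /mcoef rmorphM /=; case: regular_repE => _ -> _.
by [].
Qed.

Let mcoef_a12_0 i j x : mcoef (i, j, 0%N) (a12 * x) = 0.
Proof.
rewrite /mcoef rmorphM /=; case: regular_repE => _ -> _.
by rewrite /= mul0r.
Qed.

(** The index shift is abstracted as an action [h] of the integers, so that one induction serves
    both [a11] and [a22]. *)
Let mcoef_shift (u : A) (h : int -> I -> I) : u \is a GRing.unit ->
    (forall m, h 0 m = m) -> (forall k l m, h k (h l m) = h (k + l) m) ->
    (forall m x, mcoef (h 1 m) (u * x) = mcoef m x) ->
  forall k m x, mcoef (h k m) (u ^ k * x) = mcoef m x.
Proof.
move=> uu h0 hD h1; elim/int_rect=> [|k IH|k IH] m x.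
- by rewrite h0 mul1r.
- by rewrite -addn1 PoszD exprzDr // -mulrA -hD IH h1.
- rewrite -addn1 PoszD opprD exprzDr // -mulrA -hD IH -exprnN expr1.
  (* Writing [x] as [u * (u^-1 * x)] and [m] as [h 1 (h (-1) m)] turns the negative step into an
     instance of [h1]. *)
  by rewrite -[in RHS](mulVKr uu x) -[in RHS](h0 m) -[0](subrr 1) -hD h1.
Qed.

Lemma mcoef_torus i j m x :
  mcoef (m.1.1 + i, m.1.2 + j, m.2) (torus q i j * x) = mcoef m x.
Proof.
rewrite /torus -mulrA.
have -> := @mcoef_shift a11 (fun k m => (m.1.1 + k, m.1.2, m.2)) (a11_unit q)
   _ _ _ i (m.1.1, m.1.2 + j, m.2).
- have -> // := @mcoef_shift a22 (fun k m => (m.1.1, m.1.2 + k, m.2)) (a22_unit q).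
  + by move=> [[i' j'] n] /=; rewrite addr0.
  + by move=> k l [[i' j'] n] /=; rewrite addrAC addrA.
  + by move=> [[i' j'] n] y; exact: mcoef_a22.
- by move=> [[i' j'] n] /=; rewrite addr0.
- by move=> k l [[i' j'] n] /=; rewrite addrAC addrA.
- by move=> [[i' j'] n] y; exact: mcoef_a11.
Qed.

Lemma mcoef_mono m m' : mcoef m (mono m') = (m == m')%:R.
Proof.
case: m m' => [[i j] n] [[i' j'] n'].
(* Splitting off [i'] and [j'] lets the torus factor be removed, leaving a pure power of [a12]. *)
rewrite -[i](subrK i') -[j](subrK j') /mono.
rewrite (mcoef_torus _ _ (i - i', j - j', n)) /= !subrK.
have -> : ((i, j, n) == (i', j', n')) = ((i - i', j - j', n) == (0, 0, n')).
  by rewrite !xpair_eqE !subr_eq0.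
move: (i - i') (j - j') => {}i {}j {i' j'}.
elim: n' n => [|n' IH] [|n].
- by rewrite expr0 /mcoef rmorph1.
- by rewrite expr0 /mcoef rmorph1.
- by rewrite exprS mcoef_a12_0 xpair_eqE andbF.
- rewrite exprS mcoef_a12 IH !xpair_eqE eqSS.
  (* In the only nonzero case both torus exponents vanish, so the weight is [q ^ 0 = 1]. *)
  by case: eqP => [->|]; case: eqP => [->|]; rewrite ?mulr0 ?addr0 ?invr1 ?mul1r.
Qed.

Lemma mono_expansion x : exists s : seq I,
  [/\ uniq s, forall m, mcoef m x != 0 -> m \in s &
      x = \sum_(m <- s) mcoef m x *: mono m].
Proof.
elim/(UTq_mono_ind q_neq0): x => [|k m x [s [us sP xE]]].
  by exists [::]; split=> // [m|]; rewrite ?big_nil // linear0 eqxx.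
(* The new term may cancel an old one, so the list is only required to contain the support. *)
exists (undup (m :: s)); split=> [|m' nz|]; first exact: undup_uniq.
  rewrite mem_undup inE; apply: contraNT nz; rewrite negb_or => /andP[m'm m's].
  rewrite mcoefP mcoef_mono (negPf m'm) mulr0 add0r.
  by apply: contraNT m's => /sP.
under eq_bigr do rewrite mcoefP scalerDl.
rewrite big_split; congr (_ + _).
  rewrite (bigD1_seq m) ?mem_undup ?inE ?eqxx ?undup_uniq //= mcoef_mono eqxx mulr1.
  rewrite big1 ?addr0 // => m' m'm; rewrite mcoef_mono (negPf m'm).
  by rewrite mulr0 scale0r.
rewrite /=; case: ifP => ms; rewrite ?undup_id //.
rewrite big_cons -xE; have -> : mcoef m x = 0; last by rewrite scale0r add0r.
by apply: contraFeq ms => /sP.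
Qed.

Lemma mcoef_inj x y : (forall m, mcoef m x = mcoef m y) -> x = y.
Proof.
move=> xy; apply/eqP; rewrite -subr_eq0; have [s [_ _ ->]] := mono_expansion (x - y).
by rewrite big1 // => m _; rewrite linearB /= xy subrr scale0r.
Qed.

Lemma mcoef_neq0 x : x != 0 -> exists m, mcoef m x != 0.
Proof.
move=> x0; apply: contrapT => nx; move/eqP: x0; apply.
apply: mcoef_inj => m; rewrite linear0; apply/eqP/negPn/negP => nz.
by apply: nx; exists m.
Qed.

Lemma mono_injective : injective mono.
Proof.
move=> m m' e; apply/eqP; move: (mcoef_mono m m'); rewrite -e mcoef_mono eqxx.
by case: eqP => // _ /eqP; rewrite (negPf (oner_neq0 _)).
Qed.

Lemma mono_neq0 m : mono m != 0.
Proof.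
apply/eqP => e; move: (mcoef_mono m m); rewrite e linear0 eqxx => /esym/eqP.
by rewrite (negPf (oner_neq0 _)).
Qed.

(** The coordinate at [mono m] (x) [mono m'], computed on a chosen representative; bilinearity makes
    the choice immaterial. *)
Definition tcoef (m m' : I) (t : tens A A) : K :=
  \sum_(p <- trep t) mcoef m p.1 * mcoef m' p.2.

Fact tcoef_cls m m' s : tcoef m m' (tcls s) = \sum_(p <- s) mcoef m p.1 * mcoef m' p.2.
Proof.
apply: (@tcongr_bilinear K A A K^o (fun a b => mcoef m a * mcoef m' b));
  last exact: tclsK.
- by move=> k a a' b; rewrite mcoefP mulrDl -mulrA.
- by move=> k a b b'; rewrite mcoefP mulrDr mulrCA.
Qed.

Lemma tcoef_pure m m' x y : tcoef m m' (tpure x y) = mcoef m x * mcoef m' y.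
Proof. by rewrite tcoef_cls big_seq1. Qed.

Fact tcoef_linear m m' : linear (tcoef m m' : _ -> K^o).
Proof.
move=> k; elim/tens_ind=> s; elim/tens_ind=> t.
rewrite -[k *: _]/(tscale _ _) tscaleE -tcls_cat !tcoef_cls big_cat /= big_map.
rewrite scaler_sumr; congr (_ + _); apply: eq_bigr => p _ /=.
by rewrite linearZ; exact/esym/mulrA.
Qed.
HB.instance Definition _ m m' :=
  GRing.isLinear.Build K (tens A A) K^o _ (tcoef m m') (tcoef_linear m m').

Lemma tcoefP m m' k s t : tcoef m m' (k *: s + t) = k * tcoef m m' s + tcoef m m' t.
Proof. exact: linearP. Qed.

Lemma tcoefZ m m' k t : tcoef m m' (k *: t) = k * tcoef m m' t.
Proof. exact: linearZ. Qed.

Lemma tcoefD m m' s t : tcoef m m' (s + t) = tcoef m m' s + tcoef m m' t.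
Proof. exact: raddfD. Qed.

End Coefficients.

(** * The candidate automorphisms: existence, composition, and Hopf compatibility *)

Section TwistedScalings.
Variables (K : fieldType) (q : K) (q_neq0 : q != 0).
Local Notation A := (UTq q).
Local Notation a11 := (a11 q).
Local Notation a12 := (a12 q).
Local Notation a22 := (a22 q).
Local Notation z := (a11 / a22).
Local Notation torus := (torus q).
Local Notation mono := (mono q).
Local Notation Delta := (UTq_Delta q).
Local Notation eps := (UTq_eps q).

(** Stated for bare functions, so that it covers algebra morphisms, their composites, the identity
    and automorphisms alike. *)
Definition twisted_scaling (F : A -> A) (l : K) (j : int) : Prop :=
  [/\ F a12 = l *: (z ^ j * a12), F a11 = z ^ j * a11 & F a22 = z ^ j * a22].

Lemma zXE j : z ^ j = torus j (- j).
Proof.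
by rewrite -torus10 -torus01 torusV torusM torusXz oppr0 addr0 add0r
  mul1r mulN1r.
Qed.

Lemma zX_unit j : z ^ j \is a GRing.unit.
Proof. by rewrite zXE torus_unit. Qed.

(** Powers of [z] are central: torus elements commute, and the exponents [j] and [- j] sum to zero,
    so passing [a12] costs no factor. *)
Let zX_a11 j : z ^ j * a11 = a11 * z ^ j.
Proof. by rewrite zXE -torus10 !torusM ![1 + _]addrC ![0 + _]addrC. Qed.
Let zX_a22 j : z ^ j * a22 = a22 * z ^ j.
Proof. by rewrite zXE -torus01 !torusM ![1 + _]addrC ![0 + _]addrC. Qed.
Let zX_a12 j : z ^ j * a12 = a12 * z ^ j.
Proof. by rewrite zXE torus_a12 // subrr scale1r. Qed.

Let zX_mul2 j x y : z ^ j * x = x * z ^ j ->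
  (z ^ j * x) * (z ^ j * y) = (z ^ j * z ^ j) * (x * y).
Proof. by move=> jx; rewrite mulrA -(mulrA (z ^ j) x) -jx !mulrA. Qed.

Lemma twisted_scaling_ex l j :
  (* By centrality, both sides of each defining relation acquire the same factors. *)
  exists F : {lrmorphism A -> A}, twisted_scaling F l j.
Proof.
have [||||| F [F11 F12 F22]] :=
  @UTq_lift K q A (z ^ j * a11) (l *: (z ^ j * a12)) (z ^ j * a22).
- rewrite -scalerAr -scalerAl !zX_mul2 // a2212 -scalerAr.
  by rewrite !scalerA mulrC.
- rewrite -scalerAr -scalerAl !zX_mul2 // a1112 -scalerAr.
  by rewrite !scalerA mulrC.
- by rewrite !zX_mul2 // a1122.
- by rewrite unitrMl ?zX_unit ?a11_unit.
- by rewrite unitrMl ?zX_unit ?a22_unit.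
- by exists F.
Qed.

(** The central factor [z ^ j] cancels in the quotient of the images of [a11] and [a22]. *)
Lemma twisted_scaling_fix_z (F : {lrmorphism A -> A}) l j k :
  twisted_scaling F l j -> F (z ^ k) = z ^ k.
Proof.
move=> [_ F11 F22]; have zu : z \is a GRing.unit by have := zX_unit 1.
rewrite (rmorphXz F k zu) (rmorphM F) (rmorphV F (a22_unit q)) /= F11 F22 zX_a11 zX_a22.
by rewrite (invrM (a22_unit q) (zX_unit j)) mulrA (mulrK (zX_unit j)).
Qed.

(** Since [F] fixes the powers of [z] introduced by [G], the scalars multiply and the exponents
    add. *)
Lemma twisted_scaling_comp (F G : {lrmorphism A -> A}) l m j k :
  twisted_scaling F l j -> twisted_scaling G m k ->
  twisted_scaling (F \o G) (l * m) (j + k).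
Proof.
move=> FP [G12 G11 G22]; have Fz := twisted_scaling_fix_z k FP.
have zu : z \is a GRing.unit by have := zX_unit 1.
case: FP => F12 F11 F22; rewrite /twisted_scaling [j + k]addrC (exprzDr zu) /=.
rewrite G12 G11 G22 linearZ !(rmorphM F) /= Fz F12 F11 F22 !(mulrA (z ^ k)).
by split=> //; rewrite -scalerAr scalerA mulrA [m * l]mulrC.
Qed.

Lemma twisted_scaling_id : twisted_scaling id 1 0.
Proof. by split; rewrite expr0z mul1r ?scale1r. Qed.

Lemma twisted_scaling_uniq (F G : {lrmorphism A -> A}) l j :
  twisted_scaling F l j -> twisted_scaling G l j -> F =1 G.
Proof.
move=> [F12 F11 F22] [G12 G11 G22].
by apply: UTq_hom_ext; rewrite ?F12 ?F11 ?F22.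
Qed.

Lemma twisted_scaling_aut_ex l j : l != 0 ->
  exists phi : algAut A, twisted_scaling phi l j.
Proof.
move=> l0; have [F FP] := twisted_scaling_ex l j.
(* The inverse has the inverse parameters; both composites agree with the identity on generators. *)
have [G GP] := twisted_scaling_ex l^-1 (- j).
have FG : F \o G =1 idfun.
  have := twisted_scaling_comp FP GP; rewrite divff // subrr => h.
  exact: (@twisted_scaling_uniq (F \o G) idfun 1 0 h twisted_scaling_id).
have GF : G \o F =1 idfun.
  have := twisted_scaling_comp GP FP; rewrite mulVf // addNr => h.
  exact: (@twisted_scaling_uniq (G \o F) idfun 1 0 h twisted_scaling_id).
have Faut : is_alg_aut F.
  split; [exact: linearP | split; [exact: rmorph1 | exact: rmorphM] |].
  by exists G.
by exists (AlgAut Faut).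
Qed.

Lemma twisted_scaling_inj (F : A -> A) l m j k :
  twisted_scaling F l j -> twisted_scaling F m k -> l = m /\ j = k.
Proof.
move=> [F12 F11 _] [G12 G11 _]; have jk : j = k.
  move: G11; rewrite F11 => /(mulIr (a11_unit q)); rewrite !zXE -!mono_torus.
  by move=> /(mono_injective q_neq0) [].
split=> //; move: G12; rewrite F12 jk zXE -[_ * a12]/(mono (k, - k, 1%N)).
move/eqP; rewrite -subr_eq0 -scalerBl scaler_eq0 (negPf (mono_neq0 q_neq0 _)).
by rewrite orbF subr_eq0 => /eqP.
Qed.

Lemma Delta_torus i j : Delta (torus i j) = tpure (torus i j) (torus i j).
Proof.
have tX (x : A) k : x \is a GRing.unit -> tpure x x ^ k = tpure (x ^ k) (x ^ k).
  move=> ux; elim/int_rect: k => [|n IH|n IH]; first by rewrite !expr0z tpure1.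
    by rewrite !exprSz IH tpureM.
  have txu : tpure x x \is a GRing.unit by exact: tpure_unit.
  rewrite -addn1 PoszD opprD !exprzDr // IH -tpureM; congr (_ * _).
  apply: (mulrI txu); rewrite -exprnN expr1 divrr // tpureM -exprnN expr1.
  by rewrite divrr // tpure1.
rewrite rmorphM !rmorphXz ?a11_unit ?a22_unit //= Delta_a11 Delta_a22.
by rewrite !tX ?a11_unit ?a22_unit // tpureM.
Qed.

Lemma eps_torus i j : eps (torus i j) = 1.
Proof.
rewrite rmorphM !rmorphXz ?a11_unit ?a22_unit //= eps_a11 eps_a22.
by rewrite !exp1rz mulr1.
Qed.

(** The powers of [z] are group-like, so the identities hold on generators and hence everywhere. *)
Lemma twisted_scaling_hopf (phi : algAut A) l j :
  twisted_scaling phi l j -> hopfAut Delta eps phi.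
Proof.
move=> [p12 p11 p22]; split.
  apply: (@UTq_hom_ext _ _ _ (Delta \o phi) (tmap phi phi \o Delta)) => /=.
  - by rewrite p11 rmorphM /= Delta_a11 tmap_pure /= p11 zXE Delta_torus tpureM.
  - rewrite p12 linearZ rmorphM /= Delta_a12 raddfD /= !tmap_pure /= p11 p12 p22 !zXE.
    by rewrite Delta_torus mulrDr !tpureM tpureZl tpureZr scalerDr.
  - by rewrite p22 rmorphM /= Delta_a22 tmap_pure /= p22 zXE Delta_torus tpureM.
apply: (@UTq_hom_ext _ _ _ (eps \o phi) eps) => /=.
- by rewrite p11 rmorphM /= zXE eps_torus eps_a11 mulr1.
- by rewrite p12 linearZ rmorphM /= eps_a12 mulr0 scaler0.
- by rewrite p22 rmorphM /= zXE eps_torus eps_a22 mulr1.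
Qed.

End TwistedScalings.

(** * Grading by the degree in [a12], group-like elements and skew-primitive elements *)

Section Comultiplication.
Variables (K : fieldType) (q : K) (q_neq0 : q != 0).
Hypothesis q_nroot : forall n : nat, (0 < n)%N -> q ^+ n != 1.
Local Notation A := (UTq q).
Local Notation a11 := (a11 q).
Local Notation a12 := (a12 q).
Local Notation a22 := (a22 q).
Local Notation torus := (torus q).
Local Notation mono := (mono q).
Local Notation Delta := (UTq_Delta q).
Local Notation mcoef := (mcoef q_neq0).
Local Notation tcoef := (tcoef q_neq0).
Local Notation I := (int * int * nat)%type.

Lemma qXz_eq1 (i : int) : q ^ i = 1 -> i = 0.
Proof.
case: i => [[|n]|n] // e; have /eqP := q_nroot (ltn0Sn n) => nq.
  by case: nq.
by case: nq; rewrite -[LHS]invrK -[X in X^-1]/(q ^ Negz n) e invr1.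
Qed.

Lemma qXz_inj : injective (fun i : int => q ^ i).
Proof.
move=> i j e; apply/eqP; rewrite -subr_eq0; apply/eqP/qXz_eq1.
by rewrite expfzDr // e -expfzDr // subrr.
Qed.

(* [a12 |-> q a12] is a Hopf automorphism acting as [q ^ n] in degree [n]. *)
Lemma tcoef_Delta_deg m m' m'' :
  tcoef m m' (Delta (mono m'')) != 0 -> m''.2 = (m.2 + m'.2)%N.
Proof.
have [phi phiP] := twisted_scaling_aut_ex q_neq0 0 q_neq0.
have [phiD _] := twisted_scaling_hopf phiP.
have phi_mono k : phi (mono k) = q ^+ k.2 *: mono k.
  case: k => [[i j] n]; case: phiP => p12 p11 p22.
  rewrite /mono /torus !rmorphM rmorphXn !rmorphXz ?a11_unit ?a22_unit //=.
  by rewrite p11 p12 p22 expr0z !mul1r exprZn scalerAr.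
have mcoef_phi k x : mcoef k (phi x) = q ^+ k.2 * mcoef k x.
  elim/(UTq_mono_ind q_neq0): x => [|a k' x IH].
    by rewrite raddf0 [mcoef k 0]raddf0 mulr0.
  rewrite linearP /= phi_mono !mcoefP IH mcoefZ mcoef_mono mulrDr mulrCA.
  by case: eqP => [->|]; rewrite ?mulr0.
have tcoef_phi t : tcoef m m' (tmap phi phi t) = q ^+ (m.2 + m'.2) * tcoef m m' t.
  elim/tens_ind: t => s; rewrite tmap_cls tcoef_cls raddf_sum mulr_sumr.
  apply: eq_bigr => p _; rewrite /= tcoef_pure !mcoef_phi exprD.
  by rewrite mulrACA.
move=> nz; have := tcoef_phi (Delta (mono m'')); rewrite -phiD phi_mono linearZ /=.
(* The same coefficient is scaled by [q ^ m''.2] and by [q ^ (m.2 + m'.2)]; being nonzero, it forces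
   these powers to agree. *)
rewrite tcoefZ => /(mulIf nz) e.
have /qXz_inj [] // : q ^ m''.2%:Z = q ^ (m.2 + m'.2)%N%:Z by exact: e.
Qed.

Let deg0_neq1 m m' n : (m.2 + m'.2)%N != n.2 -> tcoef m m' (Delta (mono n)) = 0.
Proof. by move=> h; apply: contraNeq h => /tcoef_Delta_deg ->. Qed.

Lemma Delta_mono0 i j :
  Delta (mono (i, j, 0%N)) = tpure (mono (i, j, 0%N)) (mono (i, j, 0%N)).
Proof. by rewrite mono_torus Delta_torus. Qed.

Lemma Delta_mono1 i j : Delta (mono (i, j, 1%N)) =
  tpure (mono (i + 1, j, 0%N)) (mono (i, j, 1%N)) +
  tpure (mono (i, j, 1%N)) (mono (i, j + 1, 0%N)).
Proof.
rewrite -[LHS]/(Delta (torus i j * a12)) rmorphM /= Delta_torus Delta_a12 mulrDr !tpureM.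
rewrite !mono_torus -torus10 -torus01 !torusM !addr0.
by rewrite -[torus i j * a12]/(mono (i, j, 1%N)).
Qed.

(** Only monomials of degree 0 reach bidegree (0, 0), and these are group-like. *)
Lemma tcoef_Delta00 i j k l x :
  tcoef (i, j, 0%N) (k, l, 0%N) (Delta x) =
    ((i, j) == (k, l))%:R * mcoef (i, j, 0%N) x.
Proof.
elim/(UTq_mono_ind q_neq0): x => [|a [[u v] n] x IH].
  by rewrite !raddf0 mulr0.
rewrite linearP /= tcoefP IH mcoefP mulrDr mulrCA mcoef_mono; congr (a * _ + _).
case: n => [|n]; last by rewrite deg0_neq1 // !xpair_eqE andbF mulr0.
rewrite Delta_mono0 tcoef_pure !mcoef_mono !xpair_eqE eqxx !andbT.
case: (eqVneq i u) => [->|]; rewrite ?mul0r ?mulr0 //=.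
case: (eqVneq j v) => [->|]; rewrite ?mul0r ?mulr0 //=.
by rewrite mul1r mulr1 ![_ == u]eq_sym ![_ == v]eq_sym.
Qed.

(** Only monomials of degree 1 contribute, through the first term of [Delta_mono1]. *)
Lemma tcoef_Delta01 i j k l x :
  tcoef (i, j, 0%N) (k, l, 1%N) (Delta x) =
    ((i, j) == (k + 1, l))%:R * mcoef (k, l, 1%N) x.
Proof.
elim/(UTq_mono_ind q_neq0): x => [|a [[u v] n] x IH].
  by rewrite !raddf0 mulr0.
rewrite linearP /= tcoefP IH mcoefP mulrDr mulrCA mcoef_mono; congr (a * _ + _).
have [->|n1] := eqVneq n 1%N; last first.
  rewrite deg0_neq1 /= 1?eq_sym // [_ == (u, v, n)]xpair_eqE [1%N == n]eq_sym.
  by rewrite (negPf n1) andbF mulr0.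
rewrite Delta_mono1 tcoefD !tcoef_pure !mcoef_mono !xpair_eqE !andbT !andbF mul0r addr0.
case: (eqVneq k u) => [->|]; rewrite ?mulr0 //=.
by case: (eqVneq l v) => [->|]; rewrite ?mulr0.
Qed.

(** Here the second term of [Delta_mono1] is the one that contributes. *)
Lemma tcoef_Delta10 i j k l x :
  tcoef (k, l, 1%N) (i, j, 0%N) (Delta x) =
    ((i, j) == (k, l + 1))%:R * mcoef (k, l, 1%N) x.
Proof.
elim/(UTq_mono_ind q_neq0): x => [|a [[u v] n] x IH].
  by rewrite !raddf0 mulr0.
rewrite linearP /= tcoefP IH mcoefP mulrDr mulrCA mcoef_mono; congr (a * _ + _).
have [->|n1] := eqVneq n 1%N; last first.
  rewrite deg0_neq1 /= 1?eq_sym // [_ == (u, v, n)]xpair_eqE [1%N == n]eq_sym.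
  by rewrite (negPf n1) andbF mulr0.
rewrite Delta_mono1 tcoefD !tcoef_pure !mcoef_mono !xpair_eqE !andbT !andbF mul0r add0r.
case: (eqVneq k u) => [->|]; rewrite ?mul0r ?mulr0 //=.
by case: (eqVneq l v) => [->|]; rewrite ?mul0r ?mulr0 // mulrC.
Qed.

(* For [k] in the support of [g], [g (x) g] has a nonzero component of bidegree
   (deg k, deg k), so additivity of the degree puts a monomial of twice the degree
   of [k] in the support. *)
Lemma grouplike_deg0 g m : Delta g = tpure g g -> mcoef m g != 0 -> m.2 = 0%N.
Proof.
move=> gg; have [s [_ sP gE]] := mono_expansion q_neq0 g.
have double k : mcoef k g != 0 -> exists2 k', mcoef k' g != 0 & k'.2 = k.2.*2.
  move=> nz; apply: contrapT => no.
  have : tcoef k k (Delta g) != 0 by rewrite gg tcoef_pure mulf_neq0.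
  rewrite gE !raddf_sum big1 ?eqxx //= => k' _; rewrite linearZ tcoefZ.
  have [->|nz'] := eqVneq (mcoef k' g) 0; first by rewrite mul0r.
  rewrite deg0_neq1 ?mulr0 //; apply/eqP => e; apply: no; exists k' => //.
  by rewrite -e addnn.
have bound k : mcoef k g != 0 -> (k.2 <= \max_(k' <- s) k'.2)%N.
  by move=> /sP ks; rewrite (big_rem k ks) /= leq_maxl.
(* Repeated doubling of a positive degree exceeds the maximal degree over the finite list [s]. *)
have grow e : forall k, mcoef k g != 0 -> (0 < k.2)%N ->
    exists2 k', mcoef k' g != 0 & (e < k'.2)%N.
  elim: e => [|e IH] k nz kp; first by exists k.
  have [k' nz' ek'] := IH k nz kp; have [k'' nz'' k''E] := double k' nz'.
  exists k'' => //; rewrite k''E -addnn.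
  by rewrite -addn1 leq_add // (leq_trans _ ek').
move=> nz; case: (posnP m.2) => // mp.
by have [k /bound] := grow (\max_(k' <- s) k'.2)%N m nz mp; rewrite leqNgt => /negPf->.
Qed.

Lemma grouplike_torus g : Delta g = tpure g g -> g != 0 ->
  exists i j, g = torus i j.
Proof.
move=> gg /(mcoef_neq0 q_neq0) [[[i j] n] nz].
have n0 : n = 0%N := grouplike_deg0 gg nz; rewrite {}n0 in nz.
(* The coefficients are orthogonal idempotents: once one is nonzero, it equals 1 and the others
   vanish. *)
have cM k l : mcoef (i, j, 0%N) g * mcoef (k, l, 0%N) g =
    ((i, j) == (k, l))%:R * mcoef (i, j, 0%N) g.
  by rewrite -tcoef_pure -gg tcoef_Delta00.
exists i, j; rewrite -mono_torus; apply: (mcoef_inj (q_neq0 := q_neq0)) => -[[k l] n'].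
rewrite mcoef_mono; case: n' => [|n'].
  by rewrite xpair_eqE andbT [in RHS]eq_sym; apply: (mulfI nz); rewrite cM mulrC.
rewrite xpair_eqE andbF; apply/eqP/negPn/negP => /(grouplike_deg0 gg).
by [].
Qed.

(** Left and right multiplication by [torus i j] shift indices alike, but the right one adds a
    factor [q ^ (- (i + j) n)] in degree [n]. At a nonzero coefficient this gives
    [q ^ ((i + j) n) = q]. *)
Lemma skew_primitive_deg1 i j x m : x * torus i j = q^-1 *: (torus i j * x) ->
  mcoef m x != 0 -> (i + j) * m.2%:Z = 1.
Proof.
have mcoef_mulr k l n y : mcoef (k + i, l + j, n) (y * torus i j) =
    (q ^ ((i + j) * n%:Z))^-1 * mcoef (k, l, n) y.
  elim/(UTq_mono_ind q_neq0): y => [|a [[u v] n'] y IH].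
    by rewrite mul0r !raddf0 mulr0.
  rewrite mulrDl -scalerAl !mcoefP IH mulrDr mulrCA; congr (a * _ + _).
  rewrite mono_mulr_torus // mcoefZ !mcoef_mono !xpair_eqE ![_ + i]addrC ![_ + j]addrC.
  rewrite !(inj_eq (addrI _)).
  by case: (eqVneq n n') => [->//|_]; rewrite !andbF !mulr0.
case: m => [[k l] n] xq nz; have := mcoef_mulr k l n x; rewrite xq mcoefZ.
rewrite (mcoef_torus q_neq0 i j (k, l, n)) => /(mulIf nz) /invr_inj e.
by apply: qXz_inj; rewrite -e expr1z.
Qed.

End Comultiplication.

(** * Classification of the Hopf automorphisms *)

Lemma hopfAut_twisted_scaling (K : fieldType) (q : K) (q_neq0 : q != 0)
    (q_nroot : forall n : nat, (0 < n)%N -> q ^+ n != 1) (phi : algAut (UTq q)) :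
  hopfAut (UTq_Delta q) (UTq_eps q) phi ->
  exists2 l, l != 0 & exists j, twisted_scaling phi l j.
Proof.
case=> phiD _; have [_ _ /bij_inj phi_inj] := autP phi.
have phi_neq0 x : x != 0 -> phi x != 0.
  by apply: contra_neq => e; apply: phi_inj; rewrite e raddf0.
set g := phi (a11 q); set h := phi (a22 q); set y := phi (a12 q).
have [i [j gE]] : exists i j, g = torus q i j.
  apply: (grouplike_torus q_neq0 q_nroot); first by rewrite phiD Delta_a11 tmap_pure.
  by apply: phi_neq0; rewrite -torus10 -mono_torus mono_neq0.
have [k [l hE]] : exists k l, h = torus q k l.
  apply: (grouplike_torus q_neq0 q_nroot); first by rewrite phiD Delta_a22 tmap_pure.
  by apply: phi_neq0; rewrite -torus01 -mono_torus mono_neq0.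
have y_neq0 : y != 0.
  by apply: phi_neq0; rewrite -[a12 q]mul1r -torus00 (mono_neq0 q_neq0 (0, 0, 1%N)).
have yD : UTq_Delta q y = tpure g y + tpure y h.
  by rewrite phiD Delta_a12 raddfD /= !tmap_pure.
have yg : y * torus q i j = q^-1 *: (torus q i j * y).
  by rewrite -gE -!(rmorphM phi) a1112 /= linearZ /= scalerA mulVf // scale1r.
(* Each monomial in the support of [y] is tied to the fixed exponents of [g] and [h], which leaves
   room for only one. *)
have supp m : mcoef q_neq0 m y != 0 ->
    [/\ m.2 = 1%N, i + j = 1, i = m.1.1 + 1, j = m.1.2 & (k, l) = (m.1.1, m.1.2 + 1)].
  case: m => [[u v] n] nz.
  have deg1 m' : mcoef q_neq0 m' y != 0 -> m'.2 = 1%N.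
    (* A product of integers equal to 1 has factors of absolute value 1. *)
    move=> /(skew_primitive_deg1 q_nroot yg) /(congr1 absz)/eqP.
    by rewrite abszM muln_eq1 => /andP[_ /eqP].
  have y0 a b : mcoef q_neq0 (a, b, 0%N) y = 0.
    by apply/eqP/negPn/negP => /deg1.
  have n1 : n = 1%N := deg1 _ nz.
  have ij1 : i + j = 1.
    by have := skew_primitive_deg1 q_nroot yg nz; rewrite n1 mulr1.
  rewrite n1 in nz *.
  (* In bidegree (0, 1) the term [y] (x) [h] vanishes because [y] has no part of degree 0; the
     nonzero coefficient from [g] (x) [y] then forces the indices to match. *)
  have := tcoef_Delta01 q_neq0 q_nroot i j u v y.
  rewrite yD tcoefD !tcoef_pure y0 mul0r addr0 gE -mono_torus mcoef_mono eqxx.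
  move=> /(mulIf nz); case: eqP => [[iu jv] _|_ /eqP]; last by rewrite oner_eq0.
  have := tcoef_Delta10 q_neq0 q_nroot k l u v y.
  rewrite yD tcoefD !tcoef_pure y0 mulr0 add0r hE -mono_torus mcoef_mono eqxx mulrC.
  by move=> /(mulIf nz); case: eqP => [klE _|_ /eqP]; rewrite ?oner_eq0.
have [[[u v] n] nz] := mcoef_neq0 q_neq0 y_neq0.
(* From [i + j = 1], [i = u + 1] and [j = v] it follows that [v = - u], so the torus part of [y] is
   a power of [z]. *)
have [/= n1 ij1 iu jv [ku lv]] := supp _ nz; rewrite n1 in nz.
have vu : v = - u.
  by apply/eqP; rewrite -addr_eq0 addrC -(inj_eq (addIr 1)) add0r addrAC -iu -jv ij1.
exists (mcoef q_neq0 (u, v, 1%N) y) => //; exists u; rewrite /twisted_scaling zXE.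
split.
- apply: (mcoef_inj (q_neq0 := q_neq0)) => m; rewrite mcoefZ -vu.
  rewrite -[torus q u v * _]/(mono q (u, v, 1%N)) mcoef_mono.
  have [->|mn] := eqVneq m (u, v, 1%N); first by rewrite mulr1.
  rewrite mulr0; apply/eqP/negPn/negP => /supp; case: m mn => [[u' v'] n'] /=.
  move=> mn [n'1 _ iu' jv' _]; case/eqP: mn.
  by rewrite n'1 -jv' jv; congr (_, _, _); apply: (addIr 1); rewrite -iu' iu.
- by rewrite -/g gE -torus10 torusM -vu addr0 iu jv.
- by rewrite -/h hE -torus01 torusM -vu addr0 ku lv.
Qed.

Theorem corollary6p7 (K : fieldType) (charK : 2%N \notin [pchar K])
    (q : K) (q_neq0 : q != 0)
    (q_not_root_of_unity : forall n : nat, (0 < n)%N -> q ^+ n != 1) :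
  let z : UTq q := a11 q / a22 q in
  let H : set (algAut (UTq q)) :=
    [set phi : algAut (UTq q) | exists (lambda : K) (j : int),
       [/\ lambda != 0,
           phi (a12 q) = lambda *: (z ^ j * a12 q),
           phi (a11 q) = z ^ j * a11 q &
           phi (a22 q) = z ^ j * a22 q]] in
  hopfAut (UTq_Delta q) (UTq_eps q) = H /\
  (exists f : Kstar K * int -> algAut (UTq q),
     [/\ injective f,
         f @` [set: Kstar K * int] = H &
         forall (l m : Kstar K) (j k : int),
           f ((l * m)%g, j + k) = (f (l, j) * f (m, k))%g]).
Proof.
move=> z H.
have HP phi : H phi <-> exists2 l, l != 0 & exists j, twisted_scaling phi l j.
  split=> [[l [j [l0 p12 p11 p22]]]|[l l0 [j [p12 p11 p22]]]].
    by exists l => //; exists j.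
  by exists l, j.
have aut_uniq (phi psi : algAut (UTq q)) l j :
    twisted_scaling phi l j -> twisted_scaling psi l j -> phi = psi.
  by move=> h1 h2; apply: algAut_ext; exact: twisted_scaling_uniq h1 h2.
split.
  apply/seteqP; split=> phi; last by move=> /HP[l _ [j /twisted_scaling_hopf]].
  by move=> h; apply/HP; exact: hopfAut_twisted_scaling h.
(* The automorphism is picked by choice, but its parameters determine it; multiplicativity and
   surjectivity onto [H] rest on this uniqueness. *)
pose f (p : Kstar K * int) :=
  projT1 (cid (twisted_scaling_aut_ex q_neq0 p.2 (svalP p.1))).
have fP p : twisted_scaling (f p) (sval p.1) p.2.
  by rewrite /f; case: cid.
exists f; split.
- move=> [l j] [m k] e; have := fP (m, k); rewrite -e.
  by move=> /(twisted_scaling_inj q_neq0 (fP (l, j))) [/= /val_inj -> ->].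
- apply/seteqP; split=> [_ [p _ <-]|phi /HP[l l0 [j phiP]]].
    by apply/HP; exists (sval p.1); [exact: svalP p.1 | exists p.2].
  by exists (exist _ l l0, j) => //; apply: aut_uniq (fP (exist _ l l0, j)) phiP.
- move=> l m j k; apply: (aut_uniq _ _ _ _ (fP ((l * m)%g, j + k))).
  exact: twisted_scaling_comp (fP (l, j)) (fP (m, k)).
Qed.
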